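(* Let $\mathcal E,\mathcal A\in\mathbb R^{n\times n}$, $\mathcal B\in\mathbb R^{n\times m}$, $\mathcal C\in\mathbb R^{k\times n}$, $\mathcal F\in\mathbb R^{\ell\times n}$ satisfy the standing hypotheses (H1)–(H4) of the context, let $\mathcal P_+$ be the stabilizing solution fixed there and, for $t_1>0$, let $\mathcal P$ be the solution for $t\le t_1$ of the generalized differential Riccati equation specified in the context. Let $P_{\Delta;1}(t)$ be the left upper $d\times d$ block of $\mathcal P_\Delta(t):=\mathcal P(t)-\mathcal P_+$. Then $$P_{\Delta;1}(t)=e^{(t_1-t)\bar A^*}\,\bar{\tilde S}(t_1-t)\,e^{(t_1-t)\bar A},\qquad t\le t_1,$$ where $$\bar{\tilde S}(\tau):=(S-P_{+;1})\bigl[I+\bar W(\tau)(S-P_{+;1})\bigr]^{-1},\qquad \bar W(\tau):=\int_0^\tau e^{s\bar A}\bar B\bar B^*e^{s\bar A^*}\,ds,\qquad \tau\ge0,$$ are well-defined. Moreover, $P_{\Delta;1}(t)\to0$ exponentially as $t_1\to\infty$ if, and only if, $I+\bar W(S-P_{+;1})$ is nonsingular, where $\bar W:=\lim_{\tau\to\infty}\bar W(\tau)$.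
   Context: $M^*$ denotes the transpose, $M^{-*}:=(M^* )^{-1}$. Definitions: A pair $(\mathcal E,\mathcal A)$ is regular if $s\mathcal E-\mathcal A$ is invertible for some $s\in\mathbb C$. A regular pair is equivalent (by multiplication with invertible matrices from the left and right) to $\left(\begin{bmatrix}I&0\\ 0&N\end{bmatrix},\begin{bmatrix}J&0\\ 0&I\end{bmatrix}\right)$ with $J,N$ in Jordan form and $N$ nilpotent; it is finite dynamics stable if all eigenvalues of $J$ have negative real part. A regular pair is impulse-free if $\operatorname{rank}\begin{bmatrix}\mathcal E&0\\ \mathcal A&\mathcal E\end{bmatrix}=n+\operatorname{rank}\mathcal E$. The generalized algebraic Riccati equation (gARE) is $\mathcal A^*X+X^*\mathcal A-X^*\mathcal B\mathcal B^*X+\mathcal C^*\mathcal C=0$, $\mathcal E^*X=X^*\mathcal E$; a solution $\mathcal P_+$ is stabilizing if $(\mathcal E,\mathcal A-\mathcal B\mathcal B^*\mathcal P_+)$ is regular, impulse-free and finite dynamics stable. Standing hypotheses: (H1) $\mathcal E=\begin{bmatrix}I&0\\ 0&0\end{bmatrix}$ with $I\in\mathbb R^{d\times d}$. (H2) $\operatorname{range}\mathcal F^*\subset\operatorname{range}\mathcal E^*$; hence $\mathcal F^*\mathcal F=\begin{bmatrix}S&0\\ 0&0\end{bmatrix}$, which defines $S\in\mathbb R^{d\times d}$. (H3) $(\mathcal E,\mathcal A)$ is regular and the gARE has a stabilizing solution $\mathcal P_+$. (H4) With partitions conforming with $\mathcal E$, $\mathcal A=\begin{bmatrix}A_{11}&A_{12}\\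 A_{21}&A_{22}\end{bmatrix}$, $\mathcal B=\begin{bmatrix}B_1\\ B_2\end{bmatrix}$, $\mathcal C=\begin{bmatrix}C_1&C_2\end{bmatrix}$, $\mathcal P_+=\begin{bmatrix}P_{+;1}&0\\ P_{+;21}&P_{+;2}\end{bmatrix}$ (block lower triangular with $P_{+;1}$ symmetric because $\mathcal E^*\mathcal P_+=\mathcal P_+^*\mathcal E$), $P_2:=P_{+;2}$ and the regular matrix $K_2:=A_{22}^*-P_2^*B_2B_2^*$, the matrix $C_1^*C_1-(A_{21}^*P_2+C_1^*C_2)K_2^{-*}A_{21}-A_{21}^*K_2^{-1}(C_2^*C_1+P_2^*A_{21})-(C_1^*C_2+A_{21}^*P_2)K_2^{-*}B_2B_2^*K_2^{-1}(C_2^*C_1+P_2^*A_{21})$ is positive semidefinite. Notation: $\mathcal A_+:=\mathcal A-\mathcal B\mathcal B^*\mathcal P_+=\begin{bmatrix}A_{+;1}&A_{+;12}\\ A_{+;21}&A_{+;2}\end{bmatrix}$ conforming with $\mathcal E$; $A_{+;2}$ is invertible since $(\mathcal E,\mathcal A_+)$ is impulse-free; $\bar A:=A_{+;1}-A_{+;12}A_{+;2}^{-1}A_{+;21}$ and $\bar B:=B_1-A_{+;12}A_{+;2}^{-1}B_2$. The generalized differential Riccati equation (gDRE) is $-\mathcal E^*\dot{\mathcal P}=\mathcal A^*\mathcal P+\mathcal P^*\mathcal A-\mathcal P^*\mathcal B\mathcal B^*\mathcal P+\mathcal C^*\mathcal C$, $\mathcal E^*\mathcal P(t_1)=\mathcal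 F^*\mathcal F$. Under (H1)–(H4) it has a solution for $t\le t_1$; $\mathcal P$ denotes the solution of block lower triangular form $\begin{bmatrix}P_1(t)&0\\ P_{21}(t)&P_2\end{bmatrix}$, $P_1(t)$ symmetric, with constant lower right block $P_2=P_{+;2}$. $\mathcal P$ depends on $t_1$, and the limit $t_1\to\infty$ is for fixed $t$. *)

(* Defs.v *)
From HB Require Import structures.
From mathcomp Require Import all_boot all_order all_algebra.
From mathcomp Require Import complex.
From mathcomp Require Import all_classical all_reals all_analysis.
Import Order.TTheory GRing.Theory Num.Theory.
Import numFieldNormedType.Exports.

Set Implicit Arguments.
Unset Strict Implicit.
Unset Printing Implicit Defensive.

Local Open Scope classical_set_scope.
Local Open Scope ring_scope.

Section MatrixPencils.
Context {R : realType}.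

Definition complexify m n (M : 'M[R]_(m, n)) : 'M[R[i]]_(m, n) :=
  map_mx (real_complex R) M.

Definition regular_pair n (E A : 'M[R]_n) : Prop :=
  exists s : R[i], s *: complexify E - complexify A \in unitmx.

Definition jordan_form n (J : 'M[R[i]]_n) : Prop :=
  forall i j : 'I_n,
    (j != i -> nat_of_ord j != i.+1 -> J i j = 0) /\
    (nat_of_ord j = i.+1 -> J i j = 0 \/ (J i j = 1 /\ J i i = J j j)).

Definition nilpotent_mx n (N : 'M[R[i]]_n) : Prop := exists k, N ^+ k = 0.

(* The canonical form of a regular pair. The sizes of the two blocks are only
   propositionally known to sum to n, whence the casts. *)
Definition weierstrass_form n (E A : 'M[R]_n) r s
    (J : 'M[R[i]]_r) (N : 'M[R[i]]_s) : Prop :=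
  [/\ jordan_form J, jordan_form N, nilpotent_mx N &
  exists (e : (r + s)%N = n) (L T : 'M[R[i]]_n),
    [/\ L \in unitmx, T \in unitmx,
        L *m complexify E *m T = castmx (e, e) (block_mx 1%:M 0 0 N) &
        L *m complexify A *m T = castmx (e, e) (block_mx J 0 0 1%:M)]].

(* J is unique up to a permutation of its Jordan blocks, so its eigenvalues do
   not depend on the canonical form chosen. *)
Definition finite_dynamics_stable n (E A : 'M[R]_n) : Prop :=
  exists r s (J : 'M[R[i]]_r) (N : 'M[R[i]]_s),
    weierstrass_form E A J N /\
    forall z : R[i], eigenvalue J z -> complex.Re z < 0.

Definition impulse_free n (E A : 'M[R]_n) : Prop :=
  \rank (block_mx E 0 A E) = (n + \rank E)%N.

Definition psd n (M : 'M[R]_n) : Prop :=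
  M^T = M /\ forall x : 'cV[R]_n, 0 <= (x^T *m M *m x) 0 0.

End MatrixPencils.

Section Riccati.
Context {R : realType}.

Definition riccati n m k (A : 'M[R]_n) (B : 'M[R]_(n, m)) (C : 'M[R]_(k, n))
    (X : 'M[R]_n) : 'M[R]_n :=
  A^T *m X + X^T *m A - X^T *m B *m B^T *m X + C^T *m C.

Definition gARE n m k (E A : 'M[R]_n) (B : 'M[R]_(n, m)) (C : 'M[R]_(k, n))
    (X : 'M[R]_n) : Prop :=
  riccati A B C X = 0 /\ E^T *m X = X^T *m E.

Definition closed_loop n m (A : 'M[R]_n) (B : 'M[R]_(n, m)) (X : 'M[R]_n) :
  'M[R]_n := A - B *m B^T *m X.

Definition stabilizing n m k (E A : 'M[R]_n) (B : 'M[R]_(n, m))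
    (C : 'M[R]_(k, n)) (X : 'M[R]_n) : Prop :=
  [/\ gARE E A B C X, regular_pair E (closed_loop A B X),
      impulse_free E (closed_loop A B X) &
      finite_dynamics_stable E (closed_loop A B X)].

(* A solution on ]-oo, t1]: the equation holds at every t < t1, and the
   terminal value at t1 is attained from the left. *)
Definition gDRE n m k l (E A : 'M[R]_n) (B : 'M[R]_(n, m)) (C : 'M[R]_(k, n))
    (F : 'M[R]_(l, n)) (t1 : R) (P : R -> 'M[R]_n) : Prop :=
  [/\ forall t, t < t1 -> derivable P t 1,
      forall t, t < t1 -> - (E^T *m (P^`())%classic t) = riccati A B C (P t),
      P t @[t --> t1^'-] --> P t1 &
      E^T *m P t1 = F^T *m F].

Variables d q : nat.

Definition blocktri_gDRE m k l (E A : 'M[R]_(d + q)) (B : 'M[R]_(d + q, m))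
    (C : 'M[R]_(k, d + q)) (F : 'M[R]_(l, d + q)) (P2 : 'M[R]_q) (t1 : R)
    (P : R -> 'M[R]_(d + q)) : Prop :=
  gDRE E A B C F t1 P /\
  forall t, t <= t1 ->
    [/\ ursubmx (P t) = 0, drsubmx (P t) = P2 &
        (ulsubmx (P t))^T = ulsubmx (P t)].

(* The constant term of the Riccati equation left for the upper left block of
   P once its lower left block is eliminated. K2 is the transpose of the lower
   right block of closed_loop A B X, a unit if the closed loop is impulse-free
   with E = block_mx 1%:M 0 0 0. *)
Definition reduced_weight m k (A : 'M[R]_(d + q)) (B : 'M[R]_(d + q, m))
    (C : 'M[R]_(k, d + q)) (P2 : 'M[R]_q) : 'M[R]_d :=
  let A21 := dlsubmx A in
  let A22 := drsubmx A in
  let B2 := dsubmx B in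
  let C1 := lsubmx C in
  let C2 := rsubmx C in
  let K2 := A22^T - P2^T *m B2 *m B2^T in
  C1^T *m C1
  - (A21^T *m P2 + C1^T *m C2) *m invmx (K2^T) *m A21
  - A21^T *m invmx K2 *m (C2^T *m C1 + P2^T *m A21)
  - (C1^T *m C2 + A21^T *m P2) *m invmx (K2^T) *m B2 *m B2^T *m invmx K2
      *m (C2^T *m C1 + P2^T *m A21).

Definition Abar (Ap : 'M[R]_(d + q)) : 'M[R]_d :=
  ulsubmx Ap - ursubmx Ap *m invmx (drsubmx Ap) *m dlsubmx Ap.

Definition Bbar m (Ap : 'M[R]_(d + q)) (B : 'M[R]_(d + q, m)) : 'M[R]_(d, m) :=
  usubmx B - ursubmx Ap *m invmx (drsubmx Ap) *m dsubmx B.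

End Riccati.

Section GramianAndDecay.
Context {R : realType}.

Definition expmx n (A : 'M[R]_n) : 'M[R]_n :=
  limn (fun N : nat => \sum_(k < N) (k`!%:R^-1 : R) *: A ^+ k).

Definition gramian n m (A : 'M[R]_n) (B : 'M[R]_(n, m)) (tau : R) : 'M[R]_n :=
  \matrix_(i, j) (\int[lebesgue_measure]_(s in `[0, tau])
    (expmx (s *: A) *m B *m B^T *m expmx (s *: A^T)) i j)%R.

Definition gramian_oo n m (A : 'M[R]_n) (B : 'M[R]_(n, m)) : 'M[R]_n :=
  lim (gramian A B tau @[tau --> +oo]).

Definition Stilde n (W : R -> 'M[R]_n) (D : 'M[R]_n) (tau : R) : 'M[R]_n :=
  D *m invmx (1%:M + W tau *m D).

Definition exp_vanishes (V : normedModType R) (f : R -> V) : Prop :=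
  exists c a : R, 0 < a /\
    \forall x \near +oo, `|f x| <= c * expR (- (a * x)).

End GramianAndDecay.

(* Main.v *)
Require Import Defs.
From HB Require Import structures.
From mathcomp Require Import all_boot all_order all_algebra.
From mathcomp Require Import complex.
From mathcomp Require Import ring lra.
From mathcomp Require Import all_classical all_reals all_analysis.
Import Order.TTheory GRing.Theory Num.Theory.
Import numFieldNormedType.Exports.

Set Implicit Arguments.
Unset Strict Implicit.
Unset Printing Implicit Defensive.

Local Open Scope classical_set_scope.
Local Open Scope ring_scope.

(** Write [A], [B] for [Ab], [Bb], and [X] for the upper left block of
    [P(t1 - s) - Pp], where [s >= 0] is the reversed time.  Subtracting the
    algebraic Riccati equation of [Pp] removes the constant term, and the lower
    left block of the difference is a linear function of [X] because the closed
    loop has index one ([impulse_free_drsubmx_unit]).  What is left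
    ([block_quadratic]) is
<<
      X' = A^T X + X A - X B B^T X,      X(0) = D = S - P1.
>>
    Such an equation is linearised by the Hamiltonian system
    [U' = - A U + B B^T V], [V' = A^T V] with [U(0) = 1], [V(0) = D]: its
    solution gives [X = V U^-1].  Here [V = e^(sA^T) D] and
    [U = e^(-sA) (1 + W(s) D)], which is the claimed formula.

    The matrix [A] is Hurwitz, since its eigenvalues are finite eigenvalues of
    the closed loop pencil ([finite_dynamics_stable_Abar]); by Cayley-Hamilton
    [e^(sA)] then decays exponentially ([decays_expmx]).  So the Lyapunov equation
    [A L + L A^T + B B^T = 0] has a solution [L], and
    [W(s) = L - e^(sA) L e^(sA^T)] in closed form ([gramian_closed_form]).  This
    yields [Woo = L], and it makes [U] and [V] explicit in the exponential.

    The point of the weight hypothesis is that [1 + W(s) D] never becomes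
    singular ([ham_top_unit]).  The reduced weight [Q] is the constant term of
    the Riccati equation satisfied by [P1 + X] ([reduced_weightE]).  If
    [U(tau) x = 0], put [p = U x] and [q = (V + P1 U) x]; then
    [(p^T q)' = |B^T q|^2 + p^T Q p >= 0] while [p^T q] goes from
    [x^T S x >= 0] to [0].  Hence [B^T q = 0] on the whole interval, [p] solves
    a linear homogeneous equation with [p(tau) = 0], and [x = p(0) = 0].

    Uniqueness ([ric_flow_unique]) follows because, for any other solution [Z],
    [Z U - V] solves a linear homogeneous equation with initial value [0].

    For the equivalence, [e^(-sA) (1 + L D) - U = L e^(sA^T) D].  If
    [1 + L D] is invertible, then [(1 + W(s) D)^-1] stays bounded and [X] decays
    like [e^(sA)] ([ric_flow_exp_vanishes]).  If [(1 + L D) x = 0] with [x <> 0],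
    then [y = e^(sA^T) D x] is nonzero and [X L y = - y] for every [s], so [X]
    does not tend to [0] ([ric_flow_cvg0_unit]). *)

(** * Matrix identities, norms and derivatives *)

Lemma mxE_add (V : nmodType) m n (M N : 'M[V]_(m, n)) i j :
  (M + N) i j = M i j + N i j.
Proof. by rewrite mxE. Qed.

Lemma mxE_opp (V : zmodType) m n (M : 'M[V]_(m, n)) i j : (- M) i j = - M i j.
Proof. by rewrite mxE. Qed.

Lemma mxE_zero (V : nmodType) m n i j : (0 : 'M[V]_(m, n)) i j = 0.
Proof. by rewrite mxE. Qed.

Lemma trmxD (V : nmodType) m n (M N : 'M[V]_(m, n)) :
  (M + N)^T = M^T + N^T.
Proof. by apply/matrixP => i j; rewrite !mxE. Qed.

Lemma trmxN (V : zmodType) m n (M : 'M[V]_(m, n)) : (- M)^T = - M^T.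
Proof. by apply/matrixP => i j; rewrite !mxE. Qed.

Definition mx_expandE := (mulmxDl, mulmxDr, mulmxN, mulNmx, mulmx0, mul0mx,
  mulmx1, mul1mx, trmx_mul, trmxD, trmxN, mulmxA).

(** Proves an identity of noncommutative polynomials in matrices: once the
    products are expanded, each entry is a commutative identity whose atoms are
    the entries of the monomials. *)
Ltac mx_ring :=
  rewrite ?(trmxK, mx_expandE);
  apply/matrixP => ? ?; rewrite ?(mxE_add, mxE_opp, mxE_zero); ring.

Section MatrixCalculus.
Context {R : realType}.

Lemma mx_norm_ler m n (M : 'M[R]_(m, n)) (c : R) :
  0 <= c -> (`|M| <= c) <-> (forall i j, `|M i j| <= c).
Proof.
move=> c0; rewrite [`|M|]mx_normrE; split=> [Mc i j|Mc].
  by apply: le_trans Mc; apply: (le_bigmax _ (fun ij => `|M ij.1 ij.2|) (i, j)).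
by apply: bigmax_le => // ij _; exact: Mc.
Qed.

Lemma ler_mx_entry m n (M : 'M[R]_(m, n)) i j : `|M i j| <= `|M|.
Proof. by move: i j; apply/mx_norm_ler. Qed.

Lemma mx_norm_mulmx m n p (M : 'M[R]_(m, n)) (N : 'M[R]_(n, p)) :
  `|M *m N| <= n%:R * (`|M| * `|N|).
Proof.
apply/mx_norm_ler => [|i j]; first by rewrite !mulr_ge0.
rewrite mxE (le_trans (ler_norm_sum _ _ _))//.
rewrite mulr_natl -[X in _ *+ X]card_ord -sumr_const ler_sum// => k _.
by rewrite normrM ler_pM ?ler_mx_entry.
Qed.

Lemma mx_norm_tr m n (M : 'M[R]_(m, n)) : `|M^T| = `|M|.
Proof.
apply/le_anti/andP; split; apply/mx_norm_ler => // i j.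
  by rewrite mxE ler_mx_entry.
by rewrite -[M]trmxK mxE [in leRHS]trmxK ler_mx_entry.
Qed.

Lemma cvg_mxP {T : Type} {F : set_system T} {FF : Filter F} m n
    (f : T -> 'M[R]_(m, n)) (M : 'M[R]_(m, n)) :
  f x @[x --> F] --> M <-> forall i j, f x i j @[x --> F] --> M i j.
Proof.
split=> [fM i j|fM].
  exact: (cvg_comp _ _ fM (@coord_continuous R m n i j M)).
apply/cvgrPdist_le => e e0; near=> x.
apply/mx_norm_ler => [|i j]; first exact: ltW.
rewrite !mxE; move: i j; near: x.
apply: filter_forall => i; apply: filter_forall => j.
exact: ((cvgrPdist_le _ _).1 (fM i j)).
Unshelve. all: by end_near. Qed.

Lemma cvg_mulmx {T : Type} {F : set_system T} {FF : Filter F} m n p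
    (f : T -> 'M[R]_(m, n)) (g : T -> 'M[R]_(n, p))
    (M : 'M[R]_(m, n)) (N : 'M[R]_(n, p)) :
  f x @[x --> F] --> M -> g x @[x --> F] --> N ->
  f x *m g x @[x --> F] --> M *m N.
Proof.
move=> /cvg_mxP fM /cvg_mxP gN; apply/cvg_mxP => i j.
under eq_fun do rewrite mxE; rewrite mxE.
apply: cvg_big => [|k _]; first exact: add_continuous.
exact: cvgM.
Qed.

Lemma is_derive_mxP m n (f : R -> 'M[R]_(m, n)) (t : R) (df : 'M[R]_(m, n)) :
  is_derive t 1 f df <-> forall i j, is_derive t 1 (fun s => f s i j) (df i j).
Proof.
split=> [[fd fE] i j|fd].
  split; first by move: i j; apply/derivable_mxP.
  by rewrite -fE derive_mx// mxE.
have fD : derivable f t 1 by apply/derivable_mxP => i j; have [] := fd i j.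
split=> //; rewrite derive_mx//; apply/matrixP => i j; rewrite mxE.
by have [] := fd i j.
Qed.

Lemma is_derive_mulmx m n p (f : R -> 'M[R]_(m, n)) (g : R -> 'M[R]_(n, p))
    (t : R) df dg :
  is_derive t 1 f df -> is_derive t 1 g dg ->
  is_derive t 1 (fun s => f s *m g s) (df *m g t + f t *m dg).
Proof.
move=> /is_derive_mxP fd /is_derive_mxP gd; apply/is_derive_mxP => i j.
have -> : (fun s => (f s *m g s) i j) =
    \sum_(k < n) ((fun s => f s i k) * (fun s => g s k j)).
  by apply/funext => s; rewrite mxE fct_sumE.
have -> : (df *m g t + f t *m dg) i j =
    \sum_(k < n) (f t i k *: dg k j + g t k j *: df i k).
  rewrite !mxE -big_split/=; apply: eq_bigr => k _.
  by rewrite addrC; congr (_ + _); rewrite mulrC.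
by apply: is_derive_sum => k; apply: is_deriveM.
Qed.

Lemma is_derive_mulmxl m n p (M : 'M[R]_(m, n)) (g : R -> 'M[R]_(n, p)) (t : R) dg :
  is_derive t 1 g dg -> is_derive t 1 (fun s => M *m g s) (M *m dg).
Proof.
move=> gd; have := is_derive_mulmx (is_derive_cst M t 1) gd.
by rewrite mul0mx add0r.
Qed.

Lemma is_derive_mulmxr m n p (M : 'M[R]_(n, p)) (g : R -> 'M[R]_(m, n)) (t : R) dg :
  is_derive t 1 g dg -> is_derive t 1 (fun s => g s *m M) (dg *m M).
Proof.
move=> gd; have := is_derive_mulmx gd (is_derive_cst M t 1).
by rewrite mulmx0 addr0.
Qed.

Lemma is_derive_trmx m n (f : R -> 'M[R]_(m, n)) (t : R) df :
  is_derive t 1 f df -> is_derive t 1 (fun s => (f s)^T) df^T.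
Proof.
move=> /is_derive_mxP fd; apply/is_derive_mxP => i j.
by under [fun s => _]eq_fun do rewrite mxE; rewrite mxE; exact: fd.
Qed.

Lemma is_derive_mx_comp m n (f : R -> 'M[R]_(m, n)) (g : R -> R) (t : R) df dg :
  is_derive (g t) 1 f df -> is_derive t 1 g dg ->
  is_derive t 1 (fun s => f (g s)) (dg *: df).
Proof.
move=> /is_derive_mxP fd gd; apply/is_derive_mxP => i j.
rewrite mxE mulrC.
exact: (@is_derive1_comp _ (fun s => f s i j) g _ _ _ (fd i j) gd).
Qed.

Lemma is_derive_mx_continuous m n (f : R -> 'M[R]_(m, n)) (t : R) df :
  is_derive t 1 f df -> {for t, continuous f}.
Proof.
move=> [fd _]; exact/differentiable_continuous/derivable1_diffP.
Qed.

End MatrixCalculus.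

(** * The matrix exponential *)

Section MatrixExponential.
Context {R : realType}.

Lemma exprmx_entry_le n (A : 'M[R]_n) k i j :
  `|(A ^+ k) i j| <= (n%:R * `|A|) ^+ k.
Proof.
elim: k i j => [|k IH] i j.
  by rewrite !expr0 mxE; case: eqP => _; rewrite ?normr1 ?normr0.
rewrite !exprS mxE (le_trans (ler_norm_sum _ _ _))//.
rewrite -mulrA mulr_natl -[X in _ *+ X]card_ord -sumr_const ler_sum// => l _.
by rewrite normrM ler_pM ?ler_mx_entry.
Qed.

Lemma exprmxZ n (A : 'M[R]_n) (x : R) k : (x *: A) ^+ k = x ^+ k *: A ^+ k.
Proof.
elim: k => [|k IH]; first by rewrite !expr0 scale1r.
by rewrite !exprS IH -[LHS]scalemxAl -[in RHS]scalerA -scalemxAr.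
Qed.

(** The shift [r] serves the first two term-by-term derivatives of the series
    ([r = 1, 2]), whose convergence is needed to differentiate it. *)
Lemma is_cvg_pseries_expmx n (A : 'M[R]_n) r i j (x : R) :
  cvgn (pseries (fun k => k`!%:R^-1 * (A ^+ (k + r)) i j) x).
Proof.
have [c c0 Ac] : exists2 c : R, 0 <= c &
    forall k, `|(A ^+ k) i j| <= c ^+ k.
  by exists (n%:R * `|A|) => [|k]; [rewrite mulr_ge0|exact: exprmx_entry_le].
apply: normed_cvg.
apply: (@series_le_cvg _ _ (c ^+ r *: exp_coeff (c * `|x|))).
- by move=> k /=.
- by move=> k; rewrite mulr_ge0 ?exprn_ge0// divr_ge0// exprn_ge0// mulr_ge0.
- move=> k /=; rewrite [leRHS]/GRing.scale /= !normrM normfV normr_nat normrX.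
  rewrite /exp_coeff /= exprMn.
  rewrite [leRHS](_ : _ = k`!%:R^-1 * (c ^+ (k + r)) * `|x| ^+ k).
    by rewrite ler_wpM2r ?exprn_ge0// ler_wpM2l ?invr_ge0.
  by rewrite exprD /GRing.scale/=; ring.
- exact/is_cvg_seriesZ/is_cvg_series_exp_coeff.
Qed.

Lemma expmx_partial_entry n (A : 'M[R]_n) (x : R) (N : nat) i j :
  (\sum_(k < N) (k`!%:R^-1 : R) *: (x *: A) ^+ k) i j =
  pseries (fun k => k`!%:R^-1 * (A ^+ k) i j) x N.
Proof.
rewrite /pseries seriesEord summxE; apply: eq_bigr => k _.
by rewrite mxE exprmxZ mxE mulrCA mulrC.
Qed.

Lemma expmx_cvg n (A : 'M[R]_n) :
  (\sum_(k < N) (k`!%:R^-1 : R) *: A ^+ k) @[N --> \oo] --> expmx A.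
Proof.
pose l := \matrix_(i, j) limn (pseries (fun k => k`!%:R^-1 * (A ^+ k) i j) 1).
suff Al : (\sum_(k < N) (k`!%:R^-1 : R) *: A ^+ k) @[N --> \oo] --> l.
  by have := cvgP _ Al.
apply/cvg_mxP => i j; rewrite mxE -[A in X in X @ _]scale1r.
under eq_fun do rewrite expmx_partial_entry.
have := @is_cvg_pseries_expmx n A 0 i j 1.
by under [fun k => _]eq_fun do rewrite addn0.
Qed.

Lemma expmx_entry n (A : 'M[R]_n) (x : R) i j :
  expmx (x *: A) i j = limn (pseries (fun k => k`!%:R^-1 * (A ^+ k) i j) x).
Proof.
apply/esym/cvg_lim => //; have /cvg_mxP/(_ i j) := @expmx_cvg n (x *: A).
by under eq_fun do rewrite expmx_partial_entry.
Qed.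

(** Both products are limits of the same differentiated series.  This gives the
    derivative of [e^(xA)] and its commutation with [A] at once. *)
Lemma expmx_diffs_entry n (A : 'M[R]_n) (x : R) i j :
  pseries (fun k => k`!%:R^-1 * (A ^+ k.+1) i j) x N @[N --> \oo] -->
    (A *m expmx (x *: A)) i j /\
  pseries (fun k => k`!%:R^-1 * (A ^+ k.+1) i j) x N @[N --> \oo] -->
    (expmx (x *: A) *m A) i j.
Proof.
have El : A *m (\sum_(k < N) (k`!%:R^-1 : R) *: (x *: A) ^+ k) @[N --> \oo]
  --> A *m expmx (x *: A) by apply: cvg_mulmx (@expmx_cvg n _); exact: cvg_cst.
have Er : (\sum_(k < N) (k`!%:R^-1 : R) *: (x *: A) ^+ k) *m A @[N --> \oo]
  --> expmx (x *: A) *m A by apply: cvg_mulmx (@expmx_cvg n _) _; exact: cvg_cst.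
split; [move/cvg_mxP: El => /(_ i j)|move/cvg_mxP: Er => /(_ i j)];
  apply: cvg_trans; apply: near_eq_cvg;
  near=> N.
- rewrite mulmx_sumr summxE /pseries seriesEord; apply: eq_bigr => k _.
  by rewrite exprmxZ -!scalemxAr -[A *m _]/(A * A ^+ k) -exprS !mxE mulrCA mulrC.
- rewrite mulmx_suml summxE /pseries seriesEord; apply: eq_bigr => k _.
  by rewrite exprmxZ -!scalemxAl -[_ *m A]/(A ^+ k * A) -exprSr !mxE mulrCA mulrC.
Unshelve. all: by end_near. Qed.

Lemma expmx_comm n (A : 'M[R]_n) (x : R) :
  A *m expmx (x *: A) = expmx (x *: A) *m A.
Proof.
apply/matrixP => i j; have [l r] := @expmx_diffs_entry n A x i j.
exact: (cvg_unique _ l r).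
Qed.

Lemma is_derive_expmx n (A : 'M[R]_n) (x : R) :
  is_derive x 1 (fun t => expmx (t *: A)) (A *m expmx (x *: A)).
Proof.
apply/is_derive_mxP => i j.
under [fun s => _]eq_fun do rewrite expmx_entry.
pose c r k := k`!%:R^-1 * (A ^+ (k + r)) i j.
have cS r : pseries_diffs (c r) = c r.+1.
  apply/funext => k; rewrite /pseries_diffs /c factS natrM invfM addSnnS.
  by rewrite mulrA mulVKf.
have c0 : c 0%N = fun k => k`!%:R^-1 * (A ^+ k) i j.
  by apply/funext => k; rewrite /c addn0.
have c1 : c 1%N = fun k => k`!%:R^-1 * (A ^+ k.+1) i j.
  by apply/funext => k; rewrite /c addn1.
have -> : (A *m expmx (x *: A)) i j = limn (pseries (pseries_diffs (c 0%N)) x).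
  rewrite cS c1; apply/esym/cvg_lim => //.
  by have [] := @expmx_diffs_entry n A x i j.
rewrite -c0.
apply: (@pseries_snd_diffs _ _ (`|x| + 1)); rewrite ?cS.
- exact: is_cvg_pseries_expmx.
- exact: is_cvg_pseries_expmx.
- exact: is_cvg_pseries_expmx.
- by rewrite ltr_normr ltrDl ltr01.
Qed.

Lemma is_derive_mx0_cst m n (f : R -> 'M[R]_(m, n)) :
  (forall t : R, is_derive t 1 f 0) -> forall s t, f s = f t.
Proof.
move=> f0 s t; apply/matrixP => i j.
apply: (@is_derive_0_is_cst _ (fun u => f u i j)) => u.
by have /is_derive_mxP/(_ i j) := f0 u; rewrite mxE.
Qed.

Lemma expmx0 n (A : 'M[R]_n) : expmx (0 *: A) = 1%:M.
Proof.
apply: lim_near_cst; first exact: norm_hausdorff.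
near=> N; have N0 : (0 < N)%N by near: N; exists 1%N.
rewrite -(prednK N0) big_ord_recl big1 ?addr0 => [|i _].
  by rewrite fact0 invr1 scale1r.
by rewrite scale0r expr0n scaler0.
Unshelve. all: by end_near. Qed.

Lemma is_derive_expmxN n (A : 'M[R]_n) (x : R) :
  is_derive x 1 (fun t => expmx (- t *: A)) (- (A *m expmx (- x *: A))).
Proof.
rewrite -scaleN1r.
exact: (@is_derive_mx_comp _ _ _ (fun s => expmx (s *: A)) -%R x _ (-1)
  (is_derive_expmx A (- x))).
Qed.

Lemma expmxNK n (A : 'M[R]_n) (x : R) :
  expmx (- x *: A) *m expmx (x *: A) = 1%:M.
Proof.
pose f t := expmx (- t *: A) *m expmx (t *: A).
have f0 : f 0 = 1%:M by rewrite /f oppr0 !expmx0 mulmx1.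
rewrite -f0 -/(f x); apply: is_derive_mx0_cst => t.
have := is_derive_mulmx (is_derive_expmxN A t) (is_derive_expmx A t).
by rewrite (expmx_comm A (- t)) mulNmx mulmxA addNr.
Qed.

Lemma expmxKN n (A : 'M[R]_n) (x : R) :
  expmx (x *: A) *m expmx (- x *: A) = 1%:M.
Proof. by rewrite -{1}[x]opprK expmxNK. Qed.

Lemma expmx_tr n (A : 'M[R]_n) (x : R) : expmx (x *: A^T) = (expmx (x *: A))^T.
Proof.
have trX k : A^T ^+ k = (A ^+ k)^T.
  by elim: k => [|k IH]; [rewrite trmx1|rewrite exprS IH exprSr [RHS]trmx_mul].
apply/matrixP => i j; rewrite mxE !expmx_entry.
by congr (limn (pseries _ x)); apply/funext => k; rewrite trX mxE.
Qed.

End MatrixExponential.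

(** * Exponentially decaying functions *)

Section ExponentialDecay.
Context {R : realType}.

(** Stronger than [exp_vanishes]: the bound on the whole half-line also makes
    [f] bounded there and provides the initial data of energy estimates. *)
Definition decays (V : normedModType R) (f : R -> V) : Prop :=
  exists c a : R, 0 < a /\ forall t, 0 <= t -> `|f t| <= c * expR (- (a * t)).

Lemma decay_cst_ge0 (V : normedModType R) (f : R -> V) (c a : R) :
  (forall t, 0 <= t -> `|f t| <= c * expR (- (a * t))) -> 0 <= c.
Proof.
by move=> /(_ 0 (lexx _)); rewrite mulr0 oppr0 expR0 mulr1; exact: le_trans.
Qed.

Lemma is_derive_expRZ (k t : R) :
  is_derive t 1 (fun s => expR (k * s)) (k * expR (k * t)).
Proof.
have dk : is_derive t 1 (fun s => k * s) k.
  rewrite -[X in is_derive _ _ _ X]mulr1.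
  exact: (@is_deriveZ _ _ _ id k t 1 1 _).
by rewrite mulrC; exact: (@is_derive1_comp _ expR (fun s => k * s)).
Qed.

Lemma decays_common (f g : R -> R) : decays f -> decays g ->
  exists c a : R, [/\ 0 < a, 0 <= c & forall t, 0 <= t ->
    `|f t| <= c * expR (- (a * t)) /\ `|g t| <= c * expR (- (a * t))].
Proof.
move=> [c1 [a1 [a10 f1]]] [c2 [a2 [a20 g2]]].
have c10 := decay_cst_ge0 f1; have c20 := decay_cst_ge0 g2.
exists (c1 + c2), (Num.min a1 a2); split; rewrite ?lt_min ?a10 ?addr_ge0//.
have wk (c c' a a' t : R) : 0 <= c -> c <= c' -> a' <= a -> 0 <= t ->
    c * expR (- (a * t)) <= c' * expR (- (a' * t)).
  move=> c0 cc' aa t0; rewrite ler_pM ?expR_ge0// ler_expR lerN2.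
  exact: ler_wpM2r.
move=> t t0; split.
- by apply: le_trans (f1 _ t0) _; rewrite wk ?lerDl// ge_min lexx.
- by apply: le_trans (g2 _ t0) _; rewrite wk ?lerDr// ge_min lexx orbT.
Qed.

Lemma decays_le (V W : normedModType R) (k : R) (f : R -> V) (g : R -> W) :
  0 <= k -> (forall t, 0 <= t -> `|g t| <= k * `|f t|) -> decays f -> decays g.
Proof.
move=> k0 gf [c [a [a0 fc]]]; exists (k * c), a; split=> // t t0.
by apply: le_trans (gf t t0) _; rewrite -mulrA ler_wpM2l// fc.
Qed.

Lemma decaysD (f g : R -> R) :
  decays f -> decays g -> decays (fun t => f t + g t).
Proof.
move=> fd gd; have [c [a [a0 c0 fg]]] := decays_common fd gd.
exists (c + c), a; split=> // t t0; have [? ?] := fg t t0.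
by rewrite (le_trans (ler_normD _ _))// mulrDl lerD.
Qed.

Lemma decays_cst0 : decays (fun _ : R => 0 : R).
Proof. by exists 0, 1; split=> // t _; rewrite normr0 mul0r. Qed.

Lemma decays_mx m n (f : R -> 'M[R]_(m, n)) :
  (forall i j, decays (fun t => f t i j)) -> decays f.
Proof.
move=> fd; pose g t := \sum_i \sum_j `|f t i j|.
suff gd : decays g.
  apply: (decays_le (k := 1) _ _ gd) => // t _; rewrite mul1r.
  have g0 : 0 <= g t by apply: sumr_ge0 => i _; exact: sumr_ge0.
  apply/mx_norm_ler => // i j; rewrite [leRHS]ger0_norm//.
  rewrite /g (bigD1 i)//= (bigD1 j)//= -addrA lerDl addr_ge0//.
    by apply: sumr_ge0.
  by apply: sumr_ge0 => i' _; exact: sumr_ge0.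
rewrite /g.
have sumd (I : Type) (s : seq I) (F : R -> I -> R) :
    (forall i, decays (F^~ i)) -> decays (fun t => \sum_(i <- s) F t i).
  move=> Fd; elim: s => [|i s IH].
    by under eq_fun do rewrite big_nil; exact: decays_cst0.
  by under eq_fun do rewrite big_cons; exact: decaysD.
apply: (sumd) => i; apply: (sumd) => j.
by apply: (decays_le (k := 1) _ _ (fd i j)) => // t _; rewrite mul1r normr_id.
Qed.

(** Scalar equation [(u + iv)' = (al + i be) (u + iv) + forcing].  In
    [N = u^2 + v^2] the rotation [be] cancels, and Young's inequality absorbs
    half of the damping: [N' <= al N + (g^2 + h^2) / - al]. *)
Lemma decays_forced_oscillator (al be : R) (u v g h : R -> R) :
  al < 0 -> decays g -> decays h ->
  (forall t : R, is_derive t 1 u (al * u t - be * v t + g t)) ->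
  (forall t : R, is_derive t 1 v (be * u t + al * v t + h t)) ->
  decays u /\ decays v.
Proof.
move=> al0 gd hd du dv; have [c [a [a0 c0 gh]]] := decays_common gd hd.
pose b := Num.min a (- al).
have b0 : 0 < b by rewrite lt_min a0 oppr_gt0.
have ba : b <= a by rewrite ge_min lexx.
have bal : b <= - al by rewrite ge_min lexx orbT.
pose K := 2 * c ^+ 2 / - al; pose N (t : R) : R := u t * u t + v t * v t.
have K0 : 0 <= K by rewrite divr_ge0 ?mulr_ge0 ?exprn_ge0// oppr_ge0 ltW.
(* The second term absorbs the forcing, so that [phi] is nonincreasing. *)
pose phi (t : R) : R := expR (b * t) * N t +
  K / (2 * a - b) * expR ((b - 2 * a) * t).
have ab0 : 0 < 2 * a - b by lra.
pose dphi (t : R) : R := expR (b * t) *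
  (b * N t + (2 * al * N t + 2 * (u t * g t + v t * h t))) -
  K * expR ((b - 2 * a) * t).
have dph (t : R) : is_derive t 1 phi (dphi t).
  rewrite /phi /N.
  have -> : (fun t => expR (b * t) * (u t * u t + v t * v t) +
     K / (2 * a - b) * expR ((b - 2 * a) * t)) =
     (fun t => expR (b * t)) * (u * u + v * v) +
     (K / (2 * a - b)) \*: (fun t => expR ((b - 2 * a) * t)).
     by apply/funext.
  have d1 := is_deriveM (is_derive_expRZ b t)
    (is_deriveD (is_deriveM (du t) (du t)) (is_deriveM (dv t) (dv t))).
  have d2 := is_deriveZ (K / (2 * a - b)) (is_derive_expRZ (b - 2 * a) t).
  apply: (is_derive_eq (is_deriveD d1 d2)).
  rewrite /dphi /N /GRing.scale/= !fctE.
  by field; lra.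
have phi_le t : 0 <= t -> phi t <= phi 0.
  move=> t0; have := @ler0_derive1_nincr _ phi 0 t.
  move=> /(_ _ _ _ 0 t (lexx _) t0 (lexx _)); apply.
  - by move=> x _; have [] := dph x.
  - move=> x; rewrite in_itv/= => /andP[/ltW x0 _].
    rewrite derive1E; have [_ ->] := dph x.
    rewrite /dphi subr_le0.
    have -> : (b - 2 * a) * x = b * x - (a * x + a * x) by ring.
    rewrite expRD mulrCA ler_wpM2l ?expR_ge0// opprD expRD.
    have [gx hx] := gh x x0; set e := expR (- (a * x)) in gx hx *.
    have g2 : g x * g x <= (c * e) * (c * e).
      by rewrite -[leLHS]ger0_norm -?expr2 ?sqr_ge0// normrX !expr2 ler_pM.
    have h2 : h x * h x <= (c * e) * (c * e).
      by rewrite -[leLHS]ger0_norm -?expr2 ?sqr_ge0// normrX !expr2 ler_pM.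
    have young p q : 2 * (p * q) <= - al * (p * p) + q * q / - al.
      have al1 : - al * (- al)^-1 = 1 by rewrite divff// oppr_eq0 lt_eqF.
      have i0 : 0 < (- al)^-1 by rewrite invr_gt0 oppr_gt0.
      have : 0 <= (- al)^-1 * (- al * p - q) ^+ 2.
        by rewrite mulr_ge0 ?sqr_ge0// ltW.
      rewrite (_ : _ * _ ^+ 2 = (- al * (- al)^-1) * (- al * (p * p)) -
        2 * ((- al * (- al)^-1) * (p * q)) + q * q / - al); last by ring.
      by rewrite al1; lra.
    have y1 := young (u x) (g x); have y2 := young (v x) (h x).
    have N0 : 0 <= N x by rewrite /N -!expr2 addr_ge0 ?sqr_ge0.
    have i0 : 0 < (- al)^-1 by rewrite invr_gt0 oppr_gt0.
    have -> : K * (e * e) = (- al)^-1 * ((c * e) * (c * e)) +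
        (- al)^-1 * ((c * e) * (c * e)) by rewrite /K; ring.
    have g3 : g x * g x / - al <= (- al)^-1 * ((c * e) * (c * e)).
      by rewrite mulrC ler_wpM2l// ltW.
    have h3 : h x * h x / - al <= (- al)^-1 * ((c * e) * (c * e)).
      by rewrite mulrC ler_wpM2l// ltW.
    have bN : 0 <= (- al - b) * N x by rewrite mulr_ge0// subr_ge0.
    move: bN y1 y2 g3 h3; rewrite /N.
    move: (g x * g x / - al) (h x * h x / - al) ((- al)^-1 * _) => p q r.
    lra.
  - apply: continuous_subspaceT => x.
    by apply/differentiable_continuous/derivable1_diffP; have [] := dph x.
have C0 : 0 <= phi 0.
  apply: addr_ge0; apply: mulr_ge0; rewrite ?expR_ge0//.
    by rewrite /N -!expr2 addr_ge0 ?sqr_ge0.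
  by rewrite divr_ge0// ltW.
have Nle t : 0 <= t -> N t <= ((1 + phi 0) * expR (- (b / 2 * t))) ^+ 2.
  move=> t0; have : expR (b * t) * N t <= phi 0.
    apply: le_trans (phi_le _ t0); rewrite lerDl mulr_ge0 ?expR_ge0//.
    by rewrite divr_ge0// ltW.
  rewrite -ler_pdivlMl ?expR_gt0// -expRN => /le_trans; apply.
  rewrite exprMn -[in leRHS]expRM_natl.
  have -> : 2 * - (b / 2 * t) = - (b * t) by field.
  by rewrite mulrC ler_wpM2r ?expR_ge0//; nra.
have b20 : 0 < b / 2 by rewrite divr_gt0.
have bnd (w : R) t : 0 <= t -> w * w <= N t ->
    `|w| <= (1 + phi 0) * expR (- (b / 2 * t)).
  move=> t0 wN; have r0 : 0 <= (1 + phi 0) * expR (- (b / 2 * t)).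
    apply: mulr_ge0; last exact: expR_ge0.
    exact: addr_ge0.
  rewrite -(ler_pXn2r (n := 2)) ?nnegrE//.
  by rewrite real_normK ?num_real// (le_trans _ (Nle t t0)).
split; exists (1 + phi 0), (b / 2); split=> // t t0; apply: bnd => //.
  by rewrite /N lerDl -expr2 sqr_ge0.
by rewrite /N lerDr -expr2 sqr_ge0.
Qed.

End ExponentialDecay.

(** * Decay of the exponential of a Hurwitz matrix *)

Section Hurwitz.
Context {R : realType}.

Lemma map_Re_mulmx m n p (M : 'M[R[i]]_(m, n)) (A : 'M[R]_(n, p)) :
  map_mx (@complex.Re R) (M *m complexify A) = map_mx (@complex.Re R) M *m A.
Proof.
apply/matrixP => i j; rewrite !mxE raddf_sum; apply: eq_bigr => k _.
by rewrite !mxE; case: (M i k) => a b; rewrite /= mulr0 subr0.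
Qed.

Lemma map_Im_mulmx m n p (M : 'M[R[i]]_(m, n)) (A : 'M[R]_(n, p)) :
  map_mx (@complex.Im R) (M *m complexify A) = map_mx (@complex.Im R) M *m A.
Proof.
apply/matrixP => i j; rewrite !mxE raddf_sum; apply: eq_bigr => k _.
by rewrite !mxE; case: (M i k) => a b; rewrite /= mulr0 add0r.
Qed.

(** Peels off one eigenvalue at a time: [M e^(tA)] solves
    [Y' = z Y + M (A - z) e^(tA)], a scalar equation in each entry whose forcing
    decays by induction.  Real and imaginary parts are kept apart because
    derivatives are taken in [R]. *)
Lemma decays_mul_expmx m n (A : 'M[R]_n) (s : seq R[i]) (M : 'M[R[i]]_(m, n)) :
  (forall z, z \in s -> complex.Re z < 0) ->
  foldl (fun M z => M *m (complexify A - z%:M)) M s = 0 ->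
  forall i j,
    decays (fun t => (map_mx (@complex.Re R) M *m expmx (t *: A)) i j) /\
    decays (fun t => (map_mx (@complex.Im R) M *m expmx (t *: A)) i j).
Proof.
elim: s M => [|z s IH] M /= sneg M0 i j.
  by split; rewrite M0 (_ : (fun t => _) = fun=> 0);
    try exact: decays_cst0; apply/funext => t;
    rewrite (_ : map_mx _ _ = 0) ?mul0mx ?mxE//; apply/matrixP => k l; rewrite !mxE.
have := IH _ _ M0 i j; set M' := M *m _ => /(_ _)[z' zs|gd hd].
  by apply: sneg; rewrite inE zs orbT.
case: z sneg {IH M0} @M' gd hd => al be sneg M' gd hd.
have al0 : al < 0 by exact: (sneg (Complex al be) (mem_head _ _)).
have MA : M *m complexify A = M' + Complex al be *: M.
  by rewrite /M' mulmxBr mul_mx_scalar subrK.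
clearbody M'.
have dE (N : 'M[R]_(m, n)) (t : R) : is_derive t 1 (fun s => (N *m expmx (s *: A)) i j)
    ((N *m A *m expmx (t *: A)) i j).
  have := is_derive_mulmxl N (is_derive_expmx A t).
  by move=> /is_derive_mxP/(_ i j); rewrite mulmxA.
pose F (N : 'M[R]_(m, n)) (t : R) : R := (N *m expmx (t *: A)) i j.
have FD N N' t : F (N + N') t = F N t + F N' t by rewrite /F mulmxDl mxE.
have FZ c N t : F (c *: N) t = c * F N t by rewrite /F -scalemxAl mxE.
have ReMA : map_mx (@complex.Re R) M *m A = al *: map_mx (@complex.Re R) M +
    (- be) *: map_mx (@complex.Im R) M + map_mx (@complex.Re R) M'.
  rewrite -map_Re_mulmx MA; apply/matrixP => k l.
  rewrite mxE mxE raddfD/= addrC 2![in RHS]mxE; congr (_ + _); last by rewrite mxE.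
  by rewrite !mxE; case: (M k l) => x y; rewrite /= mulNr.
have ImMA : map_mx (@complex.Im R) M *m A = be *: map_mx (@complex.Re R) M +
    al *: map_mx (@complex.Im R) M + map_mx (@complex.Im R) M'.
  rewrite -map_Im_mulmx MA; apply/matrixP => k l.
  rewrite mxE mxE raddfD/= addrC 2![in RHS]mxE; congr (_ + _); last by rewrite mxE.
  by rewrite !mxE; case: (M k l) => x y; rewrite /= addrC.
have du (t : R) : is_derive t 1 (F (map_mx (@complex.Re R) M))
    (al * F (map_mx (@complex.Re R) M) t - be * F (map_mx (@complex.Im R) M) t +
     F (map_mx (@complex.Re R) M') t).
  by rewrite -mulNr -!FZ -!FD -ReMA; exact: dE.
have dv (t : R) : is_derive t 1 (F (map_mx (@complex.Im R) M))
    (be * F (map_mx (@complex.Re R) M) t + al * F (map_mx (@complex.Im R) M) t +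
     F (map_mx (@complex.Im R) M') t).
  by rewrite -!FZ -!FD -ImMA; exact: dE.
exact: (decays_forced_oscillator al0 gd hd du dv).
Qed.

(** By Cayley-Hamilton the product of all [A - z], [z] running through the
    eigenvalues, vanishes. *)
Theorem decays_expmx n (A : 'M[R]_n) :
  (forall z, eigenvalue (complexify A) z -> complex.Re z < 0) ->
  decays (fun t => expmx (t *: A)).
Proof.
case: n A => [|n] A Aneg; first by apply: decays_mx => -[].
pose Ac : 'M[R[i]]_n.+1 := complexify A.
have [s sE] := closed_field_poly_normal (char_poly Ac).
rewrite (monicP (char_poly_monic Ac)) scale1r in sE.
apply: decays_mx => i j.
have [] := @decays_mul_expmx n.+1 n.+1 A s 1%:M _ _ i j.
- move=> z zs; apply: Aneg; rewrite eigenvalue_root_char sE.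
  by rewrite root_prod_XsubC.
- have foldE (M : 'M[R[i]]_n.+1) :
    foldl (fun M z => M *m (complexify A - z%:M)) M s =
    M *m \prod_(z <- s) (Ac - z%:M).
    elim: s {sE} M => [|z s IH] M; first by rewrite big_nil mulmx1.
    by rewrite big_cons /= IH -[in RHS]mulmxE mulmxA.
  rewrite foldE mul1mx; have := Cayley_Hamilton Ac.
  rewrite sE rmorph_prod /= => <-; apply: eq_bigr => z _.
  by rewrite rmorphB /= horner_mx_X horner_mx_C.
- move=> + _; rewrite (_ : map_mx _ _ = 1%:M); last first.
    by apply/matrixP => k l; rewrite !mxE; case: eqP.
  by under eq_fun do rewrite mul1mx.
Qed.

End Hurwitz.

(** * The Lyapunov equation and the Gramian *)

Section Lyapunov.
Context {R : realType}.

Lemma decays_cvg0 (V : normedModType R) (f : R -> V) :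
  decays f -> f t @[t --> +oo] --> 0.
Proof.
move=> [c [a [a0 fc]]]; apply/cvgr0Pnorm_le => e e0.
have c0 := decay_cst_ge0 fc.
near=> t; have t0 : 0 <= t by near: t; exact: nbhs_pinfty_ge.
apply: le_trans (fc t t0) _; rewrite expRN ler_pdivrMr ?expR_gt0//.
have ct : c / (e * a) <= t.
  by near: t; apply: nbhs_pinfty_ge; exact: num_real.
apply: (@le_trans _ _ (e * (1 + a * t))); last first.
  by apply: ler_wpM2l; [exact: ltW|exact: expR_ge1Dx].
move: ct; rewrite ler_pdivrMr ?mulr_gt0// => /le_trans; apply.
by rewrite mulrCA [t * a]mulrC; apply: ler_wpM2l; [exact: ltW|rewrite lerDr].
Unshelve. all: by end_near. Qed.

Lemma decays_mulmx m n p (f : R -> 'M[R]_(m, n)) (g : R -> 'M[R]_(n, p)) :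
  decays f -> decays g -> decays (fun t => f t *m g t).
Proof.
move=> [c [a [a0 fc]]] gd.
have c0 := decay_cst_ge0 fc.
apply: (decays_le (k := n%:R * c) _ _ gd) => [|t t0]; first by rewrite mulr_ge0.
apply: le_trans (mx_norm_mulmx _ _) _; rewrite -mulrA ler_wpM2l//.
rewrite ler_wpM2r//; apply: le_trans (fc t t0) _.
rewrite -[leRHS]mulr1 ler_wpM2l// -expR0 ler_expR oppr_le0.
by rewrite mulr_ge0// ltW.
Qed.

Lemma decays_mulmxl m n p (M : 'M[R]_(m, n)) (g : R -> 'M[R]_(n, p)) :
  decays g -> decays (fun t => M *m g t).
Proof.
apply: (decays_le (k := n%:R * `|M|)) => [|t t0]; first by rewrite mulr_ge0.
by rewrite -mulrA mx_norm_mulmx.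
Qed.

Lemma decays_trmx m n (f : R -> 'M[R]_(m, n)) :
  decays f -> decays (fun t => (f t)^T).
Proof.
by apply: (decays_le (k := 1)) => // t t0; rewrite mul1r mx_norm_tr.
Qed.

(** [e^(tA) W e^(tA^T)], the solution of [Y' = A Y + Y A^T] with [Y(0) = W]. *)
Definition expmx_congr n (A W : 'M[R]_n) (t : R) : 'M[R]_n :=
  expmx (t *: A) *m W *m (expmx (t *: A))^T.

Lemma is_derive_expmx_congr n (A W : 'M[R]_n) (t : R) :
  is_derive t 1 (expmx_congr A W) (expmx_congr A (A *m W + W *m A^T) t).
Proof.
have dE := is_derive_expmx A t.
have := is_derive_mulmx (is_derive_mulmxr W dE) (is_derive_trmx dE).
move=> dW; apply: (is_derive_eq dW); rewrite /expmx_congr expmx_comm.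
by move: (expmx _) => E; mx_ring.
Qed.

Lemma expmx_congr_decays n (A W : 'M[R]_n) :
  decays (fun t => expmx (t *: A)) -> decays (expmx_congr A W).
Proof.
move=> Ed; apply: decays_mulmx (decays_trmx Ed).
have /decays_trmx := decays_mulmxl W^T (decays_trmx Ed).
by under eq_fun do rewrite trmx_mul !trmxK.
Qed.

Lemma expmx_congr0 n (A W : 'M[R]_n) : expmx_congr A W 0 = W.
Proof. by rewrite /expmx_congr expmx0 trmx1 mulmx1 mul1mx. Qed.

(** The operator [W |-> A W + W A^T] has trivial kernel because [e^(tA) W
    e^(tA^T)] is constant on that kernel while it tends to [0]. *)
Lemma lyapunov_solvable n (A Q : 'M[R]_n) :
  decays (fun t => expmx (t *: A)) ->
  exists W, A *m W + W *m A^T + Q = 0.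
Proof.
move=> Ed; pose L := lin_mulmx (p := n) A + lin_mulmxr (m := n) A^T.
have LE W : mxvec W *m L = mxvec (A *m W + W *m A^T).
  by rewrite mulmxDr !mul_vec_lin linearD.
have Lunit : L \in unitmx.
  rewrite -row_free_unit; apply: inj_row_free => v vL0.
  rewrite -[v]vec_mxK; set W := vec_mx v; apply/eqP; rewrite mxvec_eq0; apply/eqP.
  have W0 : A *m W + W *m A^T = 0.
    by apply/eqP; rewrite -mxvec_eq0 -LE vec_mxK vL0.
  have cst t : expmx_congr A W t = W.
    rewrite -[RHS](expmx_congr0 A W); apply: is_derive_mx0_cst => s.
    apply: is_derive_eq (is_derive_expmx_congr A W s) _.
    by rewrite W0 /expmx_congr mulmx0 mul0mx.
  have := decays_cvg0 (expmx_congr_decays W Ed).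
  rewrite (_ : expmx_congr A W = fun=> W); last exact/funext.
  by move/(cvg_lim (@norm_hausdorff _ _)) <-; rewrite lim_cst//; exact: norm_hausdorff.
exists (vec_mx (mxvec (- Q) *m invmx L)); set W := vec_mx _.
have WE : mxvec (A *m W + W *m A^T) = mxvec (- Q).
  by rewrite -LE vec_mxK mulmxKV.
by rewrite (can_inj mxvecK WE) addNr.
Qed.

(** [- e^(sA) W e^(sA^T)] is an antiderivative of the integrand. *)
Lemma gramian_closed_form n m (A W : 'M[R]_n) (B : 'M[R]_(n, m)) (tau : R) :
  A *m W + W *m A^T + B *m B^T = 0 -> 0 <= tau ->
  gramian A B tau = W - expmx_congr A W tau.
Proof.
move=> AW tau0; apply/matrixP => i j; rewrite mxE.
have BB : - (A *m W + W *m A^T) = B *m B^T.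
  by apply/esym/eqP; rewrite -subr_eq0 opprK addrC AW.
have fE s : expmx (s *: A) *m B *m B^T *m expmx (s *: A^T) =
    expmx_congr A (B *m B^T) s by rewrite expmx_tr /expmx_congr mulmxA.
under eq_Rintegral do rewrite fE.
move: tau0; rewrite le_eqVlt => /predU1P[<-|tau0].
  by rewrite set_itv1 Rintegral_set1 expmx_congr0 subrr mxE.
pose F s := - expmx_congr A W s i j.
have dF (s : R) : is_derive s 1 F (expmx_congr A (B *m B^T) s i j).
  have /is_derive_mxP/(_ i j) := is_derive_expmx_congr A W s.
  move=> /is_deriveN dW; apply: (is_derive_eq dW).
  by rewrite -BB /expmx_congr mulmxN mulNmx mxE_opp.
rewrite /Rintegral (@continuous_FTC2 _ _ F)//.
- by rewrite /= /F expmx_congr0 opprK addrC mxE_add mxE_opp.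
- apply: continuous_subspaceT => s.
  apply/differentiable_continuous/derivable1_diffP.
  by have /is_derive_mxP/(_ i j)[] := is_derive_expmx_congr A (B *m B^T) s.
- have cF s : {for s, continuous F}.
    by apply/differentiable_continuous/derivable1_diffP; have [] := dF s.
  split.
  + by move=> s _; have [] := dF s.
  + exact: cvg_at_right_filter (cF 0).
  + exact: cvg_at_left_filter (cF tau).
- by move=> s _; rewrite derive1E; have [] := dF s.
Qed.

Lemma gramian_cvg n m (A W : 'M[R]_n) (B : 'M[R]_(n, m)) :
  decays (fun t => expmx (t *: A)) -> A *m W + W *m A^T + B *m B^T = 0 ->
  gramian A B tau @[tau --> +oo] --> W.
Proof.
move=> Ed AW.
have : W - expmx_congr A W tau @[tau --> +oo] --> W.
  rewrite -[X in _ --> X]subr0;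
  by apply: cvgB; [exact: cvg_cst|exact/decays_cvg0/expmx_congr_decays].
apply: cvg_trans; apply: near_eq_cvg; near=> tau.
by rewrite (gramian_closed_form AW).
Unshelve. all: by end_near. Qed.

End Lyapunov.

(** * The Hamiltonian flow and its nonsingularity *)

Section HamiltonianFlow.
Context {R : realType} {n m : nat}.
Variables (A L D : 'M[R]_n) (B : 'M[R]_(n, m)).
Hypothesis lyapunov : A *m L + L *m A^T + B *m B^T = 0.

(** When [L] solves the Lyapunov equation, the solution of
    [U' = - A U + B B^T V], [V' = A^T V], [U(0) = 1], [V(0) = D].  The Gramian in
    [U = e^(-tA) (1 + W(t) D)] is expressed through [L], so that [U] is
    differentiable on all of [R]. *)
Definition ham_top (t : R) : 'M[R]_n :=
  expmx (- t *: A) *m (1%:M + L *m D) - L *m (expmx (t *: A))^T *m D.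

Definition ham_bot (t : R) : 'M[R]_n := (expmx (t *: A))^T *m D.

Lemma ham_topE (t : R) :
  ham_top t = expmx (- t *: A) *m (1%:M + (L - expmx_congr A L t) *m D).
Proof.
rewrite /ham_top /expmx_congr mulmxBl addrA [RHS]mulmxBr !mulmxA expmxNK mul1mx.
by [].
Qed.

Lemma ham_top0 : ham_top 0 = 1%:M.
Proof.
by rewrite ham_topE expmx_congr0 subrr mul0mx addr0 oppr0 expmx0 mulmx1.
Qed.

Lemma ham_bot0 : ham_bot 0 = D.
Proof. by rewrite /ham_bot expmx0 trmx1 mul1mx. Qed.

Lemma is_derive_ham_bot (t : R) :
  is_derive t 1 ham_bot (A^T *m ham_bot t).
Proof.
have := is_derive_mulmxr D (is_derive_trmx (is_derive_expmx A t)).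
move=> dV; apply: (is_derive_eq dV).
by rewrite expmx_comm trmx_mul mulmxA.
Qed.

Lemma is_derive_ham_top (t : R) :
  is_derive t 1 ham_top (- (A *m ham_top t) + B *m B^T *m ham_bot t).
Proof.
have d1 := is_derive_mulmxr (1%:M + L *m D) (is_derive_expmxN A t).
have d2 := is_derive_mulmxl L (is_derive_ham_bot t).
have -> : ham_top = (fun s => expmx (- s *: A) *m (1%:M + L *m D)) -
    (fun s => L *m ham_bot s).
  by apply/funext => s; rewrite !fctE /ham_top /ham_bot mulmxA.
apply: (is_derive_eq (is_deriveB d1 d2)).
have -> : B *m B^T = - (A *m L + L *m A^T).
  by apply/eqP; rewrite -addr_eq0 addrC lyapunov.
rewrite !fctE; move: (expmx _) (ham_bot _) => E V; mx_ring.
Qed.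

End HamiltonianFlow.

Section Nonsingularity.
Context {R : realType} {n m : nat}.
Variables (A L D P : 'M[R]_n) (B : 'M[R]_(n, m)).
Hypothesis lyapunov : A *m L + L *m A^T + B *m B^T = 0.

Lemma derive0_itv_eq p q (f : R -> 'M[R]_(p, q)) (a b : R) : a <= b ->
  (forall t, derivable f t 1) ->
  (forall t, a < t -> t < b -> is_derive t 1 f 0) -> f a = f b.
Proof.
move=> ab df f0; apply/matrixP => i j; apply/esym/eqP; rewrite -subr_eq0.
have [||c _ ->] := @MVT_segment _ (fun t => f t i j) (fun=> 0) a b ab.
- move=> t; rewrite in_itv/= => /andP[at_ tb].
  by have /is_derive_mxP/(_ i j) := f0 t at_ tb; rewrite mxE.
- apply: continuous_subspaceT => t.
  apply/differentiable_continuous/derivable1_diffP.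
  exact: ((derivable_mxP _ _ _).1 (df t) i j).
- by rewrite mul0r.
Qed.

Lemma trmx_mul_self_ge0 p (x : 'cV[R]_p) : 0 <= (x^T *m x) 0 0.
Proof. by rewrite mxE sumr_ge0// => i _; rewrite mxE -expr2 sqr_ge0. Qed.

Lemma trmx_mul_self_eq0 p (x : 'cV[R]_p) : (x^T *m x) 0 0 = 0 -> x = 0.
Proof.
rewrite mxE => /eqP; rewrite psumr_eq0 => [/allP x0|i _]; last first.
  by rewrite mxE -expr2 sqr_ge0.
apply/colP => i; rewrite mxE; apply/eqP.
by have := x0 i; rewrite mem_index_enum mxE -expr2 sqrf_eq0 => /(_ isT).
Qed.

Hypothesis Psym : P^T = P.
Hypothesis weight_ge0 : forall x : 'cV[R]_n,
  0 <= (x^T *m (- (A^T *m P + P *m A) - P *m B *m B^T *m P) *m x) 0 0.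
Hypothesis terminal_ge0 : forall x : 'cV[R]_n, 0 <= (x^T *m (D + P) *m x) 0 0.

(** With [p = U x] and [q = (V + P U) x] the pairing [p^T q] has derivative
    [|B^T q|^2 + p^T Q p >= 0], [Q] being the weight, and starts nonnegative.  If
    [U] kills [x] at time [tau], the pairing vanishes on [0 <= t <= tau], hence
    so does [B^T q], and [p] solves a linear homogeneous equation. *)
Lemma ham_top_unit (tau : R) : 0 <= tau -> ham_top A L D tau \in unitmx.
Proof.
move=> tau0; rewrite -unitmx_tr -row_free_unit; apply: inj_row_free => v.
move=> /(congr1 trmx); rewrite trmx_mul trmxK trmx0 => Ux0.
apply: trmx_inj; rewrite trmx0; set x := v^T in Ux0 *.
pose p t := ham_top A L D t *m x; pose w t := ham_bot A D t *m x.
pose q t := w t + P *m p t.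
pose dp t := - (A *m p t) + B *m B^T *m w t.
have dpE (t : R) : is_derive t 1 p (dp t).
  apply: (is_derive_eq (is_derive_mulmxr x (is_derive_ham_top D lyapunov t))).
  by rewrite /dp /p /w mulmxDl mulNmx !mulmxA.
have dqE (t : R) : is_derive t 1 q (A^T *m w t + P *m dp t).
  have dw := is_derive_mulmxr x (is_derive_ham_bot A D t).
  apply: (is_derive_eq (is_deriveD dw (is_derive_mulmxl P (dpE t)))).
  by rewrite /w mulmxA.
pose f t := ((p t)^T *m q t) 0 0.
pose r t := B^T *m q t.
pose Q := - (A^T *m P + P *m A) - P *m B *m B^T *m P.
have dfE (t : R) : is_derive t 1 f
    (((r t)^T *m r t) 0 0 + ((p t)^T *m Q *m p t) 0 0).
  have := is_derive_mulmx (is_derive_trmx (dpE t)) (dqE t).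
  move=> /is_derive_mxP/(_ 0 0) dpq; apply: (is_derive_eq dpq).
  rewrite -[RHS]mxE_add; congr (fun_of_matrix _ 0 0).
  rewrite /r /q /Q /dp; move: (p t) (w t) => y z.
  by rewrite ?(trmxK, mx_expandE) Psym; mx_ring.
have f0 : 0 <= f 0.
  rewrite /f /q /w /p ham_top0 ham_bot0 mul1mx -mulmxDl mulmxA.
  exact: terminal_ge0.
have ftau : f tau = 0 by rewrite /f /p Ux0 trmx0 mul0mx mxE.
clearbody f.
have f_nd s t : 0 <= s -> s <= t -> t <= tau -> f s <= f t.
  move=> s0 st tt; apply: (@ger0_derive1_le_cc _ f 0 tau) => //.
  - move=> u _; rewrite derive1E; have [_ ->] := dfE u.
    by apply: addr_ge0; [exact: trmx_mul_self_ge0|exact: weight_ge0].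
  - apply: continuous_subspaceT => u.
    by apply/differentiable_continuous/derivable1_diffP; have [] := dfE u.
  - by rewrite in_itv/= s0 (le_trans st).
  - by rewrite in_itv/= tt (le_trans s0).
have fz t : 0 <= t -> t <= tau -> f t = 0.
  move=> t0 tt; apply/le_anti/andP; split.
    by rewrite -ftau f_nd.
  by rewrite (le_trans f0)// f_nd.
have r0 t : 0 < t -> t < tau -> r t = 0.
  move=> t0 tt; apply: trmx_mul_self_eq0.
  have [_ fd] := dfE t.
  have : 'D_1 f t = 0.
    rewrite (@near_eq_derive _ _ _ f (cst 0))//; first exact: derive_cst.
    near=> s; apply: fz; apply/ltW; near: s.
      exact: lt_nbhsr.
    exact: lt_nbhsl.
  rewrite fd => /eqP; rewrite paddr_eq0 ?trmx_mul_self_ge0 ?weight_ge0//.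
  by case/andP => /eqP.
(* As [B^T q = 0], [p' = - At p]. *)
pose At := A + B *m B^T *m P.
pose g t := expmx (t *: At) *m p t.
have dgE (t : R) : is_derive t 1 g (expmx (t *: At) *m B *m r t).
  apply: (is_derive_eq (is_derive_mulmx (is_derive_expmx At t) (dpE t))).
  rewrite expmx_comm /r /q /dp /At; move: (expmx _) (p t) (w t) => E y z.
  mx_ring.
have gtau : g tau = 0 by rewrite /g /p Ux0 mulmx0.
have g0 : g 0 = x by rewrite /g /p expmx0 mul1mx ham_top0 mul1mx.
rewrite -g0 -gtau.
apply: derive0_itv_eq => // t t0 tt.
by apply: is_derive_eq (dgE t) _; rewrite r0// mulmx0.
Unshelve. all: by end_near. Qed.

End Nonsingularity.

(** * The Riccati flow: uniqueness *)

Section LinearOde.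
Context {R : realType}.

Lemma mx_norm_sqr_le n p (Y : 'M[R]_(n, p)) : `|Y| ^+ 2 <= \tr (Y^T *m Y).
Proof.
have trE : \tr (Y^T *m Y) = \sum_j \sum_i Y i j ^+ 2.
  apply: eq_bigr => j _; rewrite mxE; apply: eq_bigr => i _.
  by rewrite mxE expr2.
have tr0 : 0 <= \tr (Y^T *m Y).
  by rewrite trE; do 2![apply: sumr_ge0 => ? _]; exact: sqr_ge0.
rewrite -[leRHS]sqr_sqrtr// lerXn2r ?nnegrE ?sqrtr_ge0//.
apply/mx_norm_ler => [|i j]; first exact: sqrtr_ge0.
rewrite -sqrtr_sqr ler_wsqrtr// trE (bigD1 j)//= (bigD1 i)//= -addrA lerDl.
by rewrite addr_ge0 ?sumr_ge0// => *; rewrite ?sumr_ge0 ?sqr_ge0// => *; rewrite sqr_ge0.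
Qed.

(** Gronwall: [exp(-Kt) |Y|^2] is nonincreasing for [K] large. *)
Lemma linear_ode_eq0 n p (M : R -> 'M[R]_n) (Y : R -> 'M[R]_(n, p)) (mu T : R) :
  0 < T ->
  (forall t : R, 0 < t -> is_derive t 1 Y (M t *m Y t)) ->
  (forall t : R, 0 < t -> t < T -> `|M t| <= mu) ->
  Y t @[t --> 0^'+] --> Y 0 -> Y 0 = 0 -> Y T = 0.
Proof.
move=> T0 dY Mmu Y0c Y0.
have mu0 : 0 <= mu.
  by have T2 := midf_lt T0; rewrite add0r in T2; case: T2 => *;
    apply: le_trans (Mmu (T / 2) _ _).
pose N t := \tr ((Y t)^T *m Y t).
pose dN t := \tr ((M t *m Y t)^T *m Y t + (Y t)^T *m (M t *m Y t)).
pose K : R := p%:R * (2 * (n%:R * (n%:R * mu))).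
have NdN (t : R) : 0 < t -> is_derive t 1 N (dN t).
  move=> t0; have := is_derive_mulmx (is_derive_trmx (dY t t0)) (dY t t0).
  move=> /is_derive_mxP YY; rewrite /N /dN /mxtrace.
  have -> : (fun t => \sum_i ((Y t)^T *m Y t) i i) =
      \sum_(i < p) (fun t => ((Y t)^T *m Y t) i i).
    by apply/funext => s; rewrite fct_sumE.
  by apply: is_derive_sum => i; exact: YY.
have dN_le t : 0 < t -> t < T -> dN t <= K * N t.
  move=> t0 tT; have Mt := Mmu t t0 tT.
  apply: (@le_trans _ _ (K * `|Y t| ^+ 2)); last first.
    by rewrite ler_wpM2l ?mx_norm_sqr_le// !mulr_ge0.
  have MY : `|M t *m Y t| <= n%:R * (mu * `|Y t|).
    by apply: le_trans (mx_norm_mulmx _ _) _; rewrite ler_wpM2l// ler_wpM2r.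
  rewrite /dN /K -mulrA mulr_natl -[X in _ *+ X]card_ord -sumr_const.
  apply: ler_sum => i _; apply: le_trans (ler_norm _) _.
  apply: le_trans (ler_mx_entry _ _ _) _; apply: le_trans (ler_normD _ _) _.
  have -> : 2 * (n%:R * (n%:R * mu)) * `|Y t| ^+ 2 =
    n%:R * (n%:R * (mu * `|Y t|) * `|Y t|) +
    n%:R * (`|Y t| * (n%:R * (mu * `|Y t|))) by ring.
  apply: lerD; apply: le_trans (mx_norm_mulmx _ _) _; rewrite ler_wpM2l//.
    by rewrite mx_norm_tr ler_wpM2r.
  by rewrite mx_norm_tr ler_wpM2l.
pose phi (t : R) : R := expR (- K * t) * N t.
have dphi (t : R) : 0 < t ->
    is_derive t 1 phi (expR (- K * t) * (dN t - K * N t)).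
  move=> t0; apply: (is_derive_eq (is_deriveM (is_derive_expRZ (- K) t) (NdN t t0))).
  by rewrite /GRing.scale/=; ring.
have cphi : {within `[0, T], continuous phi}.
  apply: derivable_oo_LRcontinuous_within; split.
  - by move=> t; rewrite in_itv/= => /andP[t0 _]; have [] := dphi t t0.
  - have cexp : {for 0, continuous (fun s => expR (- K * s))}.
      by apply/differentiable_continuous/derivable1_diffP;
        have [] := is_derive_expRZ (- K) 0.
    apply: cvgM; first exact: (cvg_at_right_filter cexp).
    rewrite /N /mxtrace; apply: cvg_big => [|i _]; first exact: add_continuous.
    have YY : (Y t)^T *m Y t @[t --> 0^'+] --> (Y 0)^T *m Y 0.
      apply: (cvg_mulmx _ Y0c); apply/cvg_mxP => k l; rewrite mxE.
      under eq_fun do rewrite mxE.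
      by move/cvg_mxP: Y0c; exact.
    by move/cvg_mxP: YY; exact.
  - have cphi : {for T, continuous phi}.
      by apply/differentiable_continuous/derivable1_diffP; have [] := dphi T T0.
    exact: (cvg_at_left_filter cphi).
have phi_derivable t : t \in `]0, T[%R -> derivable phi t 1.
  by rewrite in_itv/= => /andP[t0 _]; have [] := dphi t t0.
have phi_nincr t : t \in `]0, T[%R -> (phi^`())%classic t <= 0.
  rewrite in_itv/= => /andP[t0 tT]; rewrite derive1E.
  have [_ ->] := dphi t t0.
  by rewrite pmulr_rle0 ?expR_gt0// subr_le0 dN_le.
have phi0 : phi 0 = 0 by rewrite /phi /N Y0 mulmx0 mxtrace0 mulr0.
have := ler0_derive1_nincr phi_derivable phi_nincr cphi (lexx 0) (ltW T0)
  (lexx T).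
rewrite phi0 {phi0}.
rewrite /phi pmulr_rle0 ?expR_gt0// => NT; apply/eqP.
rewrite -normr_eq0 -sqrf_eq0; apply/eqP/le_anti; rewrite sqr_ge0 andbT.
exact: le_trans (mx_norm_sqr_le _) NT.
Qed.

End LinearOde.

Section RiccatiFlow.
Context {R : realType} {n m : nat}.
Variables (A L D : 'M[R]_n) (B : 'M[R]_(n, m)).
Hypothesis lyapunov : A *m L + L *m A^T + B *m B^T = 0.
Hypothesis top_unit : forall t : R, 0 <= t -> ham_top A L D t \in unitmx.

(** The Riccati equation in reversed time, relative to the stationary solution:
    there is no constant term and [A] is the reduced closed loop matrix. *)
Definition ric_rhs (Z : 'M[R]_n) : 'M[R]_n :=
  A^T *m Z + Z *m A - Z *m B *m B^T *m Z.

Definition ric_flow (t : R) : 'M[R]_n := ham_bot A D t *m invmx (ham_top A L D t).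

(** A Riccati solution [Z] linearises against the Hamiltonian flow [(U, V)]:
    [Z U - V] solves a linear homogeneous equation and vanishes at [0]. *)
Lemma ric_flow_unique (Z : R -> 'M[R]_n) :
  (forall t : R, 0 < t -> is_derive t 1 Z (ric_rhs (Z t))) ->
  Z t @[t --> 0^'+] --> Z 0 -> Z 0 = D ->
  forall T, 0 <= T -> Z T = ric_flow T.
Proof.
move=> dZ Z0c Z0 T T0.
suff YT : Z T *m ham_top A L D T - ham_bot A D T = 0.
  rewrite /ric_flow; have UT := top_unit T0.
  by move/eqP: YT; rewrite subr_eq0 => /eqP <-; rewrite mulmxK.
move: T0; rewrite le_eqVlt => /predU1P[<-|T0].
  by rewrite ham_top0 ham_bot0 mulmx1 Z0 subrr.
pose Y t := Z t *m ham_top A L D t - ham_bot A D t.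
pose M t := A^T - Z t *m (B *m B^T).
have cM t : 0 < t -> {for t, continuous M}.
  move=> t0; have dM := is_derive_mulmxr (B *m B^T) (dZ t t0).
  exact: is_derive_mx_continuous (is_deriveB (is_derive_cst A^T t 1) dM).
have cM0 : M t @[t --> 0^'+] --> M 0.
  apply: cvgB; first exact: cvg_cst.
  by apply: cvg_mulmx Z0c _; exact: cvg_cst.
have [c _ cmax] : exists2 c, c \in `[0, T]%R &
    forall t, t \in `[0, T]%R -> `|M t| <= `|M c|.
  apply: (EVT_max (ltW T0)); apply/continuous_within_itvP => //; split.
  - move=> t; rewrite in_itv/= => /andP[t0 _].
    by apply: cvg_norm; exact: cM.
  - exact: cvg_norm.
  - by apply: cvg_norm; apply: cvg_at_left_filter; exact: cM.
apply: (@linear_ode_eq0 _ _ _ M Y `|M c|) => //.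
- move=> t t0; have dU := is_derive_ham_top D lyapunov t.
  have dV := is_derive_ham_bot A D t.
  apply: (is_derive_eq (is_deriveB (is_derive_mulmx (dZ t t0) dU) dV)).
  rewrite /Y /M /ric_rhs; move: (Z t) (ham_top _ _ _ t) (ham_bot _ _ t).
  by move=> z u v; mx_ring.
- by move=> t t0 tT; apply: cmax; rewrite in_itv/= !ltW.
- have cU := is_derive_mx_continuous (is_derive_ham_top D lyapunov 0).
  have cV := is_derive_mx_continuous (is_derive_ham_bot A D 0).
  apply: cvgB; last exact: (cvg_at_right_filter cV).
  exact: cvg_mulmx Z0c (cvg_at_right_filter cU).
- by rewrite /Y ham_top0 ham_bot0 mulmx1 Z0 subrr.
Qed.

End RiccatiFlow.

(** * The Riccati flow: existence *)

Section InverseDerivable.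
Context {R : realType}.

Lemma derivable_bigsum (I : Type) (s : seq I) (F : I -> R -> R) (t : R) :
  (forall i, derivable (F i) t 1) ->
  derivable (fun u => \sum_(i <- s) F i u) t 1.
Proof.
move=> dF; elim: s => [|i s IH].
  by under eq_fun do rewrite big_nil; exact: derivable_cst.
under eq_fun do rewrite big_cons.
exact: (derivableD (dF i) IH).
Qed.

Lemma derivable_bigprod (I : Type) (s : seq I) (F : I -> R -> R) (t : R) :
  (forall i, derivable (F i) t 1) ->
  derivable (fun u => \prod_(i <- s) F i u) t 1.
Proof.
move=> dF; elim: s => [|i s IH].
  by under eq_fun do rewrite big_nil; exact: derivable_cst.
under eq_fun do rewrite big_cons.
exact: (derivableM (dF i) IH).
Qed.

Lemma derivable_det n (F : R -> 'M[R]_n) (t : R) :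
  derivable F t 1 -> derivable (fun s => \det (F s)) t 1.
Proof.
move=> /derivable_mxP dF; rewrite /determinant.
apply: derivable_bigsum => s.
apply: (@derivableM _ _ (cst _)); first exact: derivable_cst.
by apply: derivable_bigprod => i; exact: dF.
Qed.

Lemma derivable_adjugate n (F : R -> 'M[R]_n) (t : R) :
  derivable F t 1 -> derivable (fun s => \adj (F s)) t 1.
Proof.
move=> /derivable_mxP dF; apply/derivable_mxP => i j.
under [fun s => _]eq_fun do rewrite mxE /cofactor.
apply: (@derivableM _ _ (cst _)); first exact: derivable_cst.
apply: derivable_det; apply/derivable_mxP => k l.
by under [fun s => _]eq_fun do rewrite !mxE; exact: dF.
Qed.

Lemma near_unitmx n (F : R -> 'M[R]_n) (t : R) :
  derivable F t 1 -> F t \in unitmx -> \forall s \near t, F s \in unitmx.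
Proof.
move=> dF Ft; have cdet : {for t, continuous (fun s => \det (F s))}.
  exact/differentiable_continuous/derivable1_diffP/derivable_det.
have dt0 : \det (F t) != 0 by rewrite -unitfE -unitmxE.
have := @cvgr_neq0 _ _ _ _ _ _ _ cdet dt0.
by move=> /(_ _); apply: filterS => s; rewrite unitmxE unitfE.
Qed.

Lemma derivable_invmx n (F : R -> 'M[R]_n) (t : R) :
  derivable F t 1 -> F t \in unitmx -> derivable (fun s => invmx (F s)) t 1.
Proof.
move=> dF Ft.
apply: (@near_eq_derivable _ _ _ (fun s => (\det (F s))^-1 *: \adj (F s))).
  by apply: filterS (near_unitmx dF Ft) => s Fs; rewrite /invmx Fs.
apply/derivable_mxP => i j.
under [fun s => _]eq_fun do rewrite mxE.
apply: (@derivableM _ _ (fun s => (\det (F s))^-1)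
  (fun s => \adj (F s) i j)).
  apply: (derivableV (f := fun s => \det (F s))); last exact: derivable_det.
  by rewrite -unitfE -unitmxE.
by move: i j; apply/derivable_mxP; exact: derivable_adjugate.
Qed.

End InverseDerivable.

Section RiccatiFlowExists.
Context {R : realType} {n m : nat}.
Variables (A L D : 'M[R]_n) (B : 'M[R]_(n, m)).
Hypothesis lyapunov : A *m L + L *m A^T + B *m B^T = 0.
Hypothesis top_unit : forall t : R, 0 <= t -> ham_top A L D t \in unitmx.

Lemma derivable_ric_flow (t : R) : 0 <= t -> derivable (ric_flow A L D) t 1.
Proof.
move=> t0; have [dU _] := is_derive_ham_top D lyapunov t.
have dI := derivable_invmx dU (top_unit t0).
have dV := is_derive_ham_bot A D t.
by have [] := is_derive_mulmx dV (DeriveDef dI erefl).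
Qed.

(** The derivative is read off the identity [X U = V]. *)
Lemma is_derive_ric_flow (t : R) : 0 < t ->
  is_derive t 1 (ric_flow A L D) (ric_rhs A B (ric_flow A L D t)).
Proof.
move=> t0; have dX := DeriveDef (derivable_ric_flow (ltW t0)) erefl.
have dU := is_derive_ham_top D lyapunov t.
have dV := is_derive_ham_bot A D t.
apply: (is_derive_eq dX).
have XU s : 0 <= s -> ric_flow A L D s *m ham_top A L D s = ham_bot A D s.
  by move=> s0; rewrite /ric_flow mulmxKV// top_unit.
have [_ dXU] := is_derive_mulmx dX dU.
have [_ dVE] := dV.
have : 'D_1 (ham_bot A D) t =
    'D_1 (fun s => ric_flow A L D s *m ham_top A L D s) t.
  apply: near_eq_derive => //.
  near=> s; rewrite XU//; apply/ltW; near: s; exact: lt_nbhsr.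
rewrite dXU dVE -(XU _ (ltW t0)).
move: ('D_1 _ t) (ric_flow _ _ _ t) => dx x dxE.
apply: (can_inj (mulmxK (top_unit (ltW t0)))).
have -> : dx *m ham_top A L D t = A^T *m (x *m ham_top A L D t) -
    x *m (- (A *m ham_top A L D t) + B *m B^T *m (x *m ham_top A L D t)).
  by rewrite dxE addrK.
by rewrite /ric_rhs; move: (ham_top _ _ _ t) => u; mx_ring.
Unshelve. all: by end_near. Qed.

Lemma ric_flow0 : ric_flow A L D 0 = D.
Proof. by rewrite /ric_flow ham_bot0 ham_top0 invmx1 mulmx1. Qed.

(** The transpose solves the same initial value problem. *)
Lemma ric_flow_sym (t : R) : D^T = D -> 0 <= t ->
  (ric_flow A L D t)^T = ric_flow A L D t.
Proof.
move=> Dsym t0.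
apply: (ric_flow_unique lyapunov top_unit (Z := fun s => (ric_flow A L D s)^T)) => //.
- move=> s s0; apply: (is_derive_eq (is_derive_trmx (is_derive_ric_flow s0))).
  by rewrite /ric_rhs; move: (ric_flow _ _ _ s) => x; mx_ring.
- have dX := is_derive_trmx (DeriveDef (derivable_ric_flow (lexx 0)) erefl).
  exact: (cvg_at_right_filter (is_derive_mx_continuous dX)).
- by rewrite ric_flow0.
Qed.

End RiccatiFlowExists.

(** * Asymptotics of the Riccati flow *)

Section Asymptotics.
Context {R : realType}.

Lemma near_pinfty_shift (P : R -> Prop) (t : R) :
  (\forall x \near +oo, P x) -> \forall x \near +oo, P (x - t).
Proof.
move=> [M [Mr PM]]; exists (M + t); split; first exact: num_real.
by move=> x Mx; apply: PM; rewrite ltrBrDr.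
Qed.

Lemma exp_vanishes_shift (V : normedModType R) (f g : R -> V) (t : R) :
  (\forall x \near +oo, f x = g (x - t)) -> exp_vanishes g -> exp_vanishes f.
Proof.
move=> fg [c [a [a0 gc]]]; exists (c * expR (a * t)), a; split=> //.
near=> x; rewrite (_ : f x = g (x - t)); last by near: x.
have -> : c * expR (a * t) * expR (- (a * x)) = c * expR (- (a * (x - t))).
  by rewrite -mulrA -expRD; congr (_ * expR _); ring.
near: x; exact: (near_pinfty_shift t gc).
Unshelve. all: by end_near. Qed.

Lemma exp_vanishes_cvg0 (V : normedModType R) (f : R -> V) :
  exp_vanishes f -> f x @[x --> +oo] --> 0.
Proof.
move=> [c [a [a0 fc]]].
have Ed : decays (fun t : R => c * expR (- (a * t))).
  by exists `|c|, a; split=> // t _; rewrite normrM [`|expR _|]ger0_norm ?expR_ge0.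
have /cvgr0Pnorm_le Ec := decays_cvg0 Ed.
apply/cvgr0Pnorm_le => e e0; near=> x.
apply: (@le_trans _ _ (c * expR (- (a * x)))); first by near: x.
apply: le_trans (ler_norm _) _; near: x; exact: Ec.
Unshelve. all: by end_near. Qed.

Context {n m : nat}.
Variables (A L D : 'M[R]_n) (B : 'M[R]_(n, m)).
Hypothesis lyapunov : A *m L + L *m A^T + B *m B^T = 0.
Hypothesis top_unit : forall t : R, 0 <= t -> ham_top A L D t \in unitmx.
Hypothesis expA_decays : decays (fun t => expmx (t *: A)).

Lemma expmx_unit (t : R) : expmx (t *: A) \in unitmx.
Proof. by have [] := mulmx1_unit (expmxKN A t). Qed.

Lemma unit_one_add_gramian (t : R) : 0 <= t ->
  1%:M + gramian A B t *m D \in unitmx.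
Proof.
move=> t0; have := top_unit t0.
by rewrite ham_topE (gramian_closed_form lyapunov t0) unitmx_mul => /andP[].
Qed.

Lemma ric_flowE (t : R) : 0 <= t ->
  ric_flow A L D t =
  expmx (t *: A^T) *m Stilde (gramian A B) D t *m expmx (t *: A).
Proof.
move=> t0; have Ut := unit_one_add_gramian t0.
apply: (can_inj (mulmxK (top_unit t0))).
rewrite [LHS]mulmxKV ?top_unit// ham_topE -(gramian_closed_form lyapunov t0).
have EE : expmx (t *: A) *m (expmx (- t *: A) *m (1%:M + gramian A B t *m D)) =
    1%:M + gramian A B t *m D by rewrite mulmxA expmxKN mul1mx.
by rewrite -[RHS]mulmxA EE -mulmxA /Stilde mulmxKV// expmx_tr.
Qed.

(** As [1 + W(t) D = (1 + L D) (1 - r(t))] with [r(t) -> 0], the inverse of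
    [1 + W(t) D] stays bounded for large [t]. *)
Lemma ric_flow_exp_vanishes :
  1%:M + L *m D \in unitmx -> exp_vanishes (ric_flow A L D).
Proof.
set K := 1%:M + L *m D => Ku.
pose M t := 1%:M + gramian A B t *m D.
pose r t := invmx K *m (expmx_congr A L t *m D).
have ME t : 0 <= t -> invmx K *m M t = 1%:M - r t.
  move=> t0; rewrite /M (gramian_closed_form lyapunov t0) mulmxBl addrA.
  by rewrite -/K mulmxBr mulVmx.
have rd : decays r.
  apply: decays_mulmxl; have Cd := expmx_congr_decays L expA_decays.
  have /decays_trmx := decays_mulmxl D^T (decays_trmx Cd).
  by under eq_fun do rewrite trmx_mul !trmxK.
pose Q t := invmx (M t) *m K.
have Qe t : 0 <= t -> Q t = 1%:M + r t *m Q t.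
  move=> t0; have : (1%:M - r t) *m Q t = 1%:M.
    rewrite -ME// /Q -mulmxA [M t *m _]mulmxA mulmxV ?unit_one_add_gramian//.
    by rewrite mul1mx mulVmx.
  by rewrite mulmxBl mul1mx => /eqP; rewrite subr_eq => /eqP.
have Qb : \forall t \near +oo, `|Q t| <= 2 * `|1%:M : 'M[R]_n|.
  have /cvgr0Pnorm_le rc := decays_cvg0 rd.
  (* [n.+1] instead of [n] covers the empty matrix. *)
  have e0 : 0 < (2 * n.+1%:R : R)^-1 by rewrite invr_gt0 mulr_gt0.
  near=> t; have t0 : 0 <= t by near: t; exact: nbhs_pinfty_ge.
  have rt : `|r t| <= (2 * n.+1%:R)^-1 by near: t; exact: rc.
  have nr : n%:R * `|r t| <= 2^-1.
    apply: (@le_trans _ _ (n.+1%:R * (2 * n.+1%:R)^-1)).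
      by rewrite ler_pM// ler_nat.
    by rewrite invfM mulrCA divff ?pnatr_eq0// mulr1.
  have := ler_normD (1%:M : 'M[R]_n) (r t *m Q t); rewrite -Qe// => Q1.
  have Q2 := mx_norm_mulmx (r t) (Q t).
  have Q3 : n%:R * (`|r t| * `|Q t|) <= 2^-1 * `|Q t|.
    by rewrite mulrA ler_wpM2r.
  by lra.
have [c [a [a0 Ec]]] := expA_decays.
have c0 := decay_cst_ge0 Ec.
pose k := n%:R * (c * (n%:R * (`|D| * (n%:R * (2 * `|1%:M : 'M[R]_n| *
  (n%:R * (`|invmx K| * c))))))).
exists k, a; split=> //; near=> t.
have t0 : 0 <= t by near: t; exact: nbhs_pinfty_ge.
have Et := Ec t t0; set e := expR (- (a * t)) in Et *.
have Ec1 : `|(expmx (t *: A))^T| <= c.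
  rewrite mx_norm_tr; apply: le_trans Et _.
  by rewrite -[leRHS]mulr1 ler_wpM2l// -expR0 ler_expR oppr_le0 mulr_ge0// ltW.
have Qt : `|Q t| <= 2 * `|1%:M : 'M[R]_n| by near: t.
have -> : ric_flow A L D t =
    (expmx (t *: A))^T *m (D *m (Q t *m (invmx K *m expmx (t *: A)))).
  rewrite ric_flowE// expmx_tr /Stilde /Q.
  by rewrite -[in RHS]mulmxA [K *m _]mulmxA mulmxV// mul1mx !mulmxA.
have -> : k * e = n%:R * (c * (n%:R * (`|D| * (n%:R * (2 * `|1%:M : 'M[R]_n| *
    (n%:R * (`|invmx K| * (c * e)))))))) by rewrite /k; ring.
have step p q s (X : 'M[R]_(p, q)) (Y : 'M[R]_(q, s)) (x y : R) :
    `|X| <= x -> `|Y| <= y -> `|X *m Y| <= q%:R * (x * y).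
  move=> Xx Yy; apply: le_trans (mx_norm_mulmx _ _) _.
  by rewrite ler_wpM2l// ler_pM.
by do 4!apply: (step) => //.
Unshelve. all: by end_near. Qed.

(** A kernel vector [x] of [1 + L D] yields [X(t) L y = - y] with
    [y = e^(tA^T) D x <> 0], which keeps [X(t)] away from [0]. *)
Lemma ric_flow_cvg0_unit :
  ric_flow A L D t @[t --> +oo] --> (0 : 'M[R]_n) -> 1%:M + L *m D \in unitmx.
Proof.
move=> X0; rewrite -unitmx_tr -row_free_unit; apply: inj_row_free => v.
move=> /(congr1 trmx); rewrite trmx_mul trmxK trmx0.
move=> Kx; apply: trmx_inj; rewrite trmx0; apply/eqP.
set x := v^T in Kx *; apply: contraT => x0.
(* Small enough for [X L y = - y] to give [|y| <= |y| / 2]. *)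
have e0 : 0 < (n.+1%:R * (n.+1%:R * (1 + `|L|)) *+ 2 : R)^-1.
  by rewrite invr_gt0 mulrn_wgt0// !mulr_gt0// ltr_wpDr.
have /cvgr0Pnorm_le/(_ _ e0) Xe := X0.
near (pinfty_nbhs R) => t; have t0 : 0 <= t by near: t; exact: nbhs_pinfty_ge.
have Xt : `|ric_flow A L D t| <=
  (n.+1%:R * (n.+1%:R * (1 + `|L|)) *+ 2 : R)^-1 by near: t.
pose y := (expmx (t *: A))^T *m (D *m x).
have XLy : ric_flow A L D t *m (L *m y) = - y.
  have Vx : ham_bot A D t *m x = y by rewrite /ham_bot /y mulmxA.
  have Ux : ham_top A L D t *m x = - (L *m y).
    by rewrite /ham_top /y mulmxBl -!mulmxA Kx mulmx0 sub0r.
  by rewrite -[LHS]opprK -mulmxN -Ux mulmxA /ric_flow mulmxKV ?top_unit// Vx.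
have y0 : 0 < `|y|.
  rewrite normr_gt0; apply: contraNneq x0 => y0.
  have Dx : D *m x = 0.
    have Eu : (expmx (t *: A))^T \in unitmx by rewrite unitmx_tr expmx_unit.
    by rewrite -[D *m x](mulKmx Eu) -/y y0 mulmx0.
  by move: Kx; rewrite mulmxDl mul1mx -mulmxA Dx mulmx0 addr0 => ->.
have := mx_norm_mulmx (ric_flow A L D t) (L *m y); rewrite XLy normrN.
have := mx_norm_mulmx L y.
set X := `|ric_flow A L D t| in Xt *; set N : R := n%:R => Ly yX.
have NS : N <= n.+1%:R by rewrite ler_nat.
have NX : N * X * (N * `|L|) <= 2^-1.
  apply: (@le_trans _ _ (n.+1%:R * X * (n.+1%:R * (1 + `|L|)))).
    apply: ler_pM; rewrite ?mulr_ge0 ?normr_ge0 ?ler0n//.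
      by apply: ler_wpM2r; first exact: normr_ge0.
    by apply: ler_pM; rewrite ?normr_ge0 ?ler0n// lerDr.
  rewrite mulrAC mulrC -ler_pdivlMr ?mulr_gt0 ?ltr_wpDr//.
  by rewrite -invfM [2 * _]mulr_natl.
have : `|y| <= 2^-1 * `|y|.
  apply: le_trans yX _; apply: (@le_trans _ _ (N * (X * (N * (`|L| * `|y|))))).
    by apply: ler_wpM2l; [exact: ler0n|apply: ler_wpM2l => //; exact: normr_ge0].
  have -> : N * (X * (N * (`|L| * `|y|))) = N * X * (N * `|L|) * `|y| by ring.
  by rewrite ler_wpM2r.
by rewrite leNgt gtr_pMl// invf_lt1 ?ltr1n.
Unshelve. all: by end_near. Qed.

End Asymptotics.

(** * Spectrum and index of the closed loop *)

Section FiniteDynamics.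
Context {R : realType}.

(** A left kernel vector satisfies [v = z v N], hence [v = z^k v N^k]. *)
Lemma nilpotent_pencil_unit (F : fieldType) n (N : 'M[F]_n) (z : F) k :
  N ^+ k = 0 -> z *: N - 1%:M \in unitmx.
Proof.
move=> Nk; rewrite -row_free_unit; apply: inj_row_free => v.
rewrite mulmxBr mulmx1 -scalemxAr => /eqP; rewrite subr_eq0 => /eqP vN.
have vj j : v = z ^+ j *: (v *m N ^+ j).
  elim: j => [|j IH]; first by rewrite !expr0 scale1r mulmx1.
  transitivity (z ^+ j *: ((z *: (v *m N)) *m N ^+ j)); first by rewrite vN.
  by rewrite -scalemxAl scalerA -mulmxA -exprSr [N ^+ j.+1]exprS.
by rewrite (vj k) Nk mulmx0 scaler0.
Qed.

(** The sizes [r + s] and [n] agree only propositionally: stating this for a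
    variable [n] allows the cast to be eliminated. *)
Lemma weierstrass_pencil_unit (F : fieldType) n r s (e : (r + s)%N = n)
    (L T E A : 'M[F]_n) (J : 'M[F]_r) (N : 'M[F]_s) (z : F) k :
  N ^+ k = 0 ->
  L *m E *m T = castmx (e, e) (block_mx 1%:M 0 0 N) ->
  L *m A *m T = castmx (e, e) (block_mx J 0 0 1%:M) ->
  z%:M - J \in unitmx -> L *m (z *: E - A) *m T \in unitmx.
Proof.
move=> Nk; case: n / e L T E A => L T E A; rewrite !castmx_id => LE LA zJ.
rewrite mulmxBr mulmxBl -scalemxAr -scalemxAl LE LA scale_block_mx.
rewrite opp_block_mx add_block_mx !scaler0 !subr0 scalemx1.
by rewrite unitmxE det_ublock unitrM -!unitmxE zJ (nilpotent_pencil_unit _ Nk).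
Qed.

(** A left eigenvector [v] of the Schur complement [Abar] lifts to the left
    kernel vector [(v, - v A12 A22^-1)] of the pencil [z E - A]. *)
Lemma finite_dynamics_stable_Abar d q (A : 'M[R]_(d + q)) :
  drsubmx A \in unitmx ->
  finite_dynamics_stable (block_mx 1%:M 0 0 0) A ->
  forall z, eigenvalue (complexify (Abar A)) z -> complex.Re z < 0.
Proof.
move=> A2u [r [s [J [N [[_ _ [k Nk] [e [L [T [Lu Tu LE LA]]]]] Jneg]]]]] z.
case/eigenvalueP => v vA v0; apply: Jneg; apply: contraT => zJ.
have zJu : z%:M - J \in unitmx.
  rewrite -opprB -scaleN1r unitmxZ ?unitrN1// -row_free_unit -kermx_eq0.
  by move: zJ; rewrite negbK.
have := weierstrass_pencil_unit Nk LE LA zJu.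
rewrite !unitmx_mul Lu Tu /= andbT => zEA.
set c := @complexify R; pose A12 := c _ _ (ursubmx A); pose A2 := c _ _ (drsubmx A).
have A2cu : A2 \in unitmx by rewrite /A2 /c /complexify map_unitmx.
pose w := row_mx v (- (v *m A12 *m invmx A2)).
have cA : complexify A = block_mx (c _ _ (ulsubmx A)) A12 (c _ _ (dlsubmx A)) A2.
  by rewrite -[in LHS](submxK A) /complexify map_block_mx.
have cE : complexify (block_mx 1%:M 0 0 0 : 'M[R]_(d + q)) = block_mx 1%:M 0 0 0.
  by rewrite /complexify map_block_mx map_mx1 !map_mx0.
have : w *m (z *: complexify (block_mx 1%:M 0 0 0) - complexify A) = 0.
  rewrite cA cE scale_block_mx !scaler0 opp_block_mx add_block_mx !add0r.
  rewrite mul_row_block -row_mx0; congr row_mx; last first.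
    by rewrite mulmxN mulNmx mulmxN opprK mulmxKV// addNr.
  move: vA; rewrite /Abar /complexify map_mxB !map_mxM map_invmx mulmxBr.
  rewrite -/(complexify _) => /eqP; rewrite subr_eq => /eqP vA.
  rewrite mulmxBr -scalemxAr mulmx1 mulNmx mulmxN opprK /c vA.
  by rewrite opprD addrA subrr sub0r !mulmxA addNr.
move=> /(congr1 (mulmx^~ (invmx (z *: complexify (block_mx 1%:M 0 0 0) - complexify A)))).
rewrite mulmxK// mul0mx -row_mx0 => /eq_row_mx[v00 _].
by rewrite v00 eqxx in v0.
Qed.

(** The rows of [E] eliminate the left blocks of [A], so that the rows of the
    extended matrix lie in the span of [2 d] rows and the rows of the lower right
    block; rank [(d + q) + d] then forces that block to have rank [q]. *)
Lemma impulse_free_drsubmx_unit d q (A : 'M[R]_(d + q)) :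
  impulse_free (block_mx 1%:M 0 0 0) A -> drsubmx A \in unitmx.
Proof.
rewrite /impulse_free -[A]submxK block_mxKdr; set E := block_mx 1%:M 0 0 0.
move: (ulsubmx A) (ursubmx A) (dlsubmx A) (drsubmx A) => a1 a12 a21 a2.
have rE : \rank E = d by rewrite rank_diag_block_mx mxrank1 mxrank0 addn0.
rewrite rE => rk.
rewrite -row_free_unit -row_leq_rank.
pose X : 'M[R]_(d, (d + q) + (d + q)) :=
  row_mx (row_mx 1%:M 0) 0.
pose Y : 'M[R]_(d, (d + q) + (d + q)) :=
  row_mx (row_mx 0 a12) (row_mx 1%:M 0).
pose Z : 'M[R]_(q, (d + q) + (d + q)) := row_mx (row_mx 0 a2) 0.
have sub : (block_mx E 0 (block_mx a1 a12 a21 a2) E <= X + Y + Z)%MS.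
  have XS : (X <= X + Y + Z)%MS by rewrite -addsmxA addsmxSl.
  have YS : (Y <= X + Y + Z)%MS.
    by rewrite (submx_trans (addsmxSr X Y))// addsmxSl.
  have ZS : (Z <= X + Y + Z)%MS by rewrite addsmxSr.
  have -> : block_mx E 0 (block_mx a1 a12 a21 a2) E =
      col_mx (col_mx X 0) (col_mx (a1 *m X + Y) (a21 *m X + Z)).
    have rows p (a b : 'M[R]_(d, p)) (a' b' : 'M[R]_(q, p)) :
        row_mx (col_mx a a') (col_mx b b') =
        col_mx (row_mx a b) (row_mx a' b') by rewrite -block_mxEh block_mxEv.
    rewrite /X /Y /Z !mul_mx_row !mulmx1 !mulmx0 !add_row_mx !addr0 !add0r.
    rewrite [LHS]block_mxEv /E !block_mxEv !rows.
    rewrite -[X in col_mx (row_mx _ X) _](col_mx0 _ _ _ _) rows.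
    by rewrite !row_mx0.
  rewrite !col_mx_sub XS sub0mx /=.
  by rewrite !addmx_sub ?mulmx_sub.
have rX : (\rank X <= d)%N by exact: rank_leq_row.
have rY : (\rank Y <= d)%N by exact: rank_leq_row.
have rZ : (\rank Z <= \rank a2)%N.
  have -> : Z = a2 *m row_mx (row_mx 0 1%:M) 0.
    by rewrite !mul_mx_row !mulmx0 mulmx1.
  exact: mxrankM_maxl.
have := mxrankS sub; rewrite rk => rk1.
have rk2 : (\rank (X + Y + Z)%MS <= \rank X + \rank Y + \rank Z)%N.
  apply: leq_trans (mxrank_adds_leqif _ _) _.
  by rewrite leq_add2r mxrank_adds_leqif.
have := leq_trans rk1 (leq_trans rk2 (leq_add (leq_add rX rY) rZ)).
by rewrite addnAC leq_add2l.
Qed.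

End FiniteDynamics.

(** * Elimination of the lower left block *)

Section BlockReduction.
Context {R : realType}.

Lemma riccati_shift n m k (A : 'M[R]_n) (B : 'M[R]_(n, m)) (C : 'M[R]_(k, n))
    (X Y : 'M[R]_n) :
  riccati A B C (X + Y) = riccati A B C X +
    ((closed_loop A B X)^T *m Y + Y^T *m closed_loop A B X -
     Y^T *m B *m B^T *m Y).
Proof. by rewrite /riccati /closed_loop; mx_ring. Qed.

Variables d q m : nat.

(** The lower left block is a linear constraint on [G]; solving it
    for [G] amounts to taking the Schur complement [Abar], [Bbar] of the closed
    loop. *)
Lemma block_quadratic (A : 'M[R]_(d + q)) (B : 'M[R]_(d + q, m))
    (X : 'M[R]_d) (G : 'M[R]_(q, d)) :
  drsubmx A \in unitmx -> X^T = X ->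
  let Y := block_mx X 0 G 0 in
  let rhs := A^T *m Y + Y^T *m A - Y^T *m B *m B^T *m Y in
  dlsubmx rhs = (ursubmx A)^T *m X + (drsubmx A)^T *m G /\
  (G = - ((ursubmx A *m invmx (drsubmx A))^T *m X) ->
   rhs = block_mx (ric_rhs (Abar A) (Bbar A B) X) 0 0 0).
Proof.
rewrite -[A]submxK -[B]vsubmxK /Abar /Bbar !block_mxKul !block_mxKur
  !block_mxKdl !block_mxKdr !col_mxKu !col_mxKd.
move: (ulsubmx A) (ursubmx A) (dlsubmx A) (drsubmx A) (usubmx B) (dsubmx B).
move=> a1 a12 a21 a2 b1 b2 a2u Xs /=.
have -> : (block_mx a1 a12 a21 a2)^T *m block_mx X 0 G 0 +
    (block_mx X 0 G 0)^T *m block_mx a1 a12 a21 a2 -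
    (block_mx X 0 G 0)^T *m col_mx b1 b2 *m (col_mx b1 b2)^T *m
      block_mx X 0 G 0 =
    block_mx (a1^T *m X + a21^T *m G + (X *m a1 + G^T *m a21) -
        (X *m b1 + G^T *m b2) *m (b1^T *m X + b2^T *m G))
      (X *m a12 + G^T *m a2) (a12^T *m X + a2^T *m G) 0.
  rewrite !tr_block_mx tr_col_mx !mulmx_block -mulmxA mul_row_block.
  rewrite mul_block_col mul_col_row opp_block_mx !add_block_mx !trmx0 Xs.
  by rewrite !(mulmx0, mul0mx, addr0, add0r, oppr0).
rewrite block_mxKdl; split=> // ->.
pose H := a12 *m invmx a2.
have a12E : a12 = H *m a2 by rewrite /H mulmxKV.
rewrite -/H {1 2}a12E; congr block_mx.
- by rewrite /ric_rhs ?(trmxK, mx_expandE) Xs; mx_ring.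
- by rewrite ?(trmxK, mx_expandE) Xs; mx_ring.
- by mx_ring.
Qed.

Lemma closed_loop_block (A11 : 'M[R]_d) (A12 : 'M[R]_(d, q))
    (A21 : 'M[R]_(q, d)) (A22 : 'M[R]_q) (B1 : 'M[R]_(d, m))
    (B2 : 'M[R]_(q, m)) (P1 : 'M[R]_d) (Y : 'M[R]_(q, d)) (P2 : 'M[R]_q) :
  closed_loop (block_mx A11 A12 A21 A22) (col_mx B1 B2) (block_mx P1 0 Y P2) =
  block_mx (A11 - B1 *m (B1^T *m P1 + B2^T *m Y)) (A12 - B1 *m (B2^T *m P2))
    (A21 - B2 *m (B1^T *m P1 + B2^T *m Y)) (A22 - B2 *m (B2^T *m P2)).
Proof.
rewrite /closed_loop tr_col_mx -mulmxA mul_row_block mul_col_row opp_block_mx.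
by rewrite add_block_mx !mulmx0 !add0r.
Qed.

(** The Schur complement of the Riccati operator at [P1 = 0].  The lower left
    block of the algebraic equation expresses [K2^-1 (C2^T C1 + P2^T A21)]
    through [P1] and [P21], and the upper left one expresses [C1^T C1]. *)
Lemma reduced_weight_block k (A11 : 'M[R]_d) (A12 : 'M[R]_(d, q))
    (A21 : 'M[R]_(q, d)) (A22 : 'M[R]_q) (B1 : 'M[R]_(d, m))
    (B2 : 'M[R]_(q, m)) (C1 : 'M[R]_(k, d)) (C2 : 'M[R]_(k, q))
    (P1 : 'M[R]_d) (Y : 'M[R]_(q, d)) (P2 : 'M[R]_q) :
  let A := block_mx A11 A12 A21 A22 in
  let B := col_mx B1 B2 in
  let C := row_mx C1 C2 in
  let X := block_mx P1 0 Y P2 in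
  let Ap := closed_loop A B X in
  drsubmx Ap \in unitmx -> P1^T = P1 -> riccati A B C X = 0 ->
  reduced_weight A B C P2 =
    - ((Abar Ap)^T *m P1 + P1 *m Abar Ap) -
    P1 *m Bbar Ap B *m (Bbar Ap B)^T *m P1.
Proof.
move=> A B C X Ap; rewrite /Ap /A /B /C /X closed_loop_block.
rewrite /Abar /Bbar /reduced_weight !block_mxKul !block_mxKur !block_mxKdl
  !block_mxKdr !col_mxKu !col_mxKd !row_mxKl !row_mxKr.
set be := B1^T *m P1 + B2^T *m Y.
set a2 := A22 - _; set a12 := A12 - _ => a2u P1s ric0.
have beT : be^T = P1 *m B1 + Y^T *m B2.
  by rewrite /be trmxD !trmx_mul !trmxK P1s.
have [ul dl] :
    A11^T *m P1 + A21^T *m Y + (P1 *m A11 + Y^T *m A21) - be^T *m be +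
      C1^T *m C1 = 0 /\
    A12^T *m P1 + A22^T *m Y + P2^T *m A21 - (B2^T *m P2)^T *m be +
      C2^T *m C1 = 0.
  move: ric0; rewrite /riccati !tr_block_mx tr_row_mx !mulmx_block.
  rewrite -[_ *m (col_mx _ _)^T *m _]mulmxA tr_col_mx mul_row_block.
  rewrite mul_block_col !mul_col_row opp_block_mx.
  rewrite !add_block_mx !trmx0 P1s !(mulmx0, mul0mx, addr0, add0r) -/be.
  rewrite -block_mx0 => /eq_block_mx[ulE _ dlE _]; split.
    by rewrite -[RHS]ulE beT.
  by rewrite -[RHS]dlE trmx_mul trmxK.
have K2E : A22^T - P2^T *m B2 *m B2^T = a2^T.
  by rewrite /a2; mx_ring.
rewrite K2E trmxK.
pose H := a12 *m invmx a2.
have gE : invmx a2^T *m (C2^T *m C1 + P2^T *m A21) = - (H^T *m P1 + Y).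
  have -> : C2^T *m C1 + P2^T *m A21 = - (a12^T *m P1 + a2^T *m Y).
    apply/eqP; rewrite -addr_eq0 -[X in _ == X]dl; apply/eqP.
    by rewrite /a12 /a2 /be; mx_ring.
  rewrite mulmxN mulmxDr mulKmx ?unitmx_tr// mulmxA /H trmx_mul trmx_inv.
  by [].
have gtE : (A21^T *m P2 + C1^T *m C2) *m invmx a2 = - (H^T *m P1 + Y)^T.
  rewrite -trmxN -gE trmx_mul trmx_inv trmxK; congr (_ *m _).
  by rewrite trmxD !trmx_mul !trmxK addrC.
rewrite [C1^T *m C2 + _]addrC -!mulmxA gE !mulmxA gtE.
have -> : C1^T *m C1 = be^T *m be -
    (A11^T *m P1 + A21^T *m Y + (P1 *m A11 + Y^T *m A21)).
  by apply/eqP; rewrite -subr_eq0 opprB addrC -ul; apply/eqP; rewrite addrA addrAC.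
rewrite -/H; clearbody H; rewrite /be ?(trmxK, mx_expandE) P1s; mx_ring.
Qed.

Lemma reduced_weightE k (A : 'M[R]_(d + q)) (B : 'M[R]_(d + q, m))
    (C : 'M[R]_(k, d + q)) (X : 'M[R]_(d + q)) :
  let Ap := closed_loop A B X in
  let P1 := ulsubmx X in
  drsubmx Ap \in unitmx -> ursubmx X = 0 -> P1^T = P1 ->
  riccati A B C X = 0 ->
  reduced_weight A B C (drsubmx X) =
    - ((Abar Ap)^T *m P1 + P1 *m Abar Ap) -
    P1 *m Bbar Ap B *m (Bbar Ap B)^T *m P1.
Proof.
move=> Ap P1 Au X0 P1s ric0.
have XE : X = block_mx P1 0 (dlsubmx X) (drsubmx X) by rewrite -X0 submxK.
have := @reduced_weight_block k (ulsubmx A) (ursubmx A) (dlsubmx A) (drsubmx A)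
  (usubmx B) (dsubmx B) (lsubmx C) (rsubmx C) P1 (dlsubmx X) (drsubmx X).
by rewrite /= !submxK !vsubmxK !hsubmxK -XE; exact.
Qed.

End BlockReduction.

(** * Solutions of the generalized differential Riccati equation *)

Lemma submxB (V : zmodType) m1 m2 n1 n2 (M N : 'M[V]_(m1 + m2, n1 + n2)) :
  (ulsubmx (M - N) = ulsubmx M - ulsubmx N) *
  (ursubmx (M - N) = ursubmx M - ursubmx N) *
  (drsubmx (M - N) = drsubmx M - drsubmx N).
Proof. by do !split; apply/matrixP => i j; rewrite !mxE. Qed.

Lemma submxD (V : nmodType) m1 m2 n1 n2 (M N : 'M[V]_(m1 + m2, n1 + n2)) :
  (ulsubmx (M + N) = ulsubmx M + ulsubmx N) *
  (ursubmx (M + N) = ursubmx M + ursubmx N).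
Proof. by split; apply/matrixP => i j; rewrite !mxE. Qed.

Section SemiExplicit.
Context {R : realType} {d q m k l : nat}.

Lemma proj_tr_mul p (M : 'M[R]_(d + q, d + p)) :
  (block_mx 1%:M 0 0 0 : 'M[R]_(d + q))^T *m M =
  block_mx (ulsubmx M) (ursubmx M) 0 0.
Proof.
rewrite -[M in LHS]submxK tr_block_mx mulmx_block trmx1 !trmx0.
by rewrite !mul1mx !mul0mx !addr0.
Qed.

Lemma symmetric_pencil_blocks (X : 'M[R]_(d + q)) :
  let E := block_mx 1%:M 0 0 0 in
  E^T *m X = X^T *m E -> ursubmx X = 0 /\ (ulsubmx X)^T = ulsubmx X.
Proof.
move=> E; rewrite -[RHS]trmxK trmx_mul trmxK proj_tr_mul tr_block_mx !trmx0.
by case/eq_block_mx => ulE urE _ _.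
Qed.

Lemma gram_of_subrows (F : 'M[R]_(l, d + q)) :
  (F <= (block_mx 1%:M 0 0 0 : 'M[R]_(d + q)))%MS ->
  F^T *m F = block_mx (ulsubmx (F^T *m F)) 0 0 0 /\
  forall x : 'cV[R]_d, 0 <= (x^T *m ulsubmx (F^T *m F) *m x) 0 0.
Proof.
case/submxP => M ->; rewrite -[M]hsubmxK mul_row_block !mulmx1 !mulmx0 !addr0.
rewrite tr_row_mx mul_col_row !trmx0 !mulmx0 !mul0mx block_mxKul; split=> // x.
by rewrite -mulmxA -mulmxA mulmxA -trmx_mul trmx_mul_self_ge0.
Qed.

Lemma is_derive_ulsubmx (f : R -> 'M[R]_(d + q)) (t : R) df :
  is_derive t 1 f df -> is_derive t 1 (fun s => ulsubmx (f s)) (ulsubmx df).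
Proof.
move=> /is_derive_mxP fd; apply/is_derive_mxP => i j.
by under [fun s => _]eq_fun do rewrite !mxE; rewrite !mxE; exact: fd.
Qed.

Lemma is_derive_reversed_time (t1 t : R) :
  is_derive t 1 (fun u => t1 - u) (-1).
Proof.
rewrite -[X in is_derive _ _ _ X]sub0r.
exact: (is_deriveB (is_derive_cst t1 t 1) (is_derive_id t 1)).
Qed.

Lemma cvg_reversed_time (V : topologicalType) (f : R -> V) (t1 : R) (y : V) :
  f t @[t --> t1^'-] --> y -> f (t1 - s) @[s --> 0^'+] --> y.
Proof.
move=> fy; apply: (cvg_comp (fun s => t1 - s) f _ fy) => Q Qt1.
have ct : (t1 - s) @[s --> (0 : R)] --> t1 - 0.
  exact: (cvgB (cvg_cst t1) cvg_id).
rewrite subr0 in ct.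
have ct' : \forall s \near 0^'+, t1 - s < t1 -> Q (t1 - s).
  exact: (cvg_at_right_filter ct Qt1).
suff : \forall s \near 0^'+, Q (t1 - s) by [].
near=> s; have s0 : 0 < s by near: s; exact: nbhs_right_gt.
have : t1 - s < t1 by rewrite ltrBlDr ltrDl.
by near: s.
Unshelve. all: by end_near. Qed.

Variables (A : 'M[R]_(d + q)) (B : 'M[R]_(d + q, m)) (C : 'M[R]_(k, d + q)).
Variables (F : 'M[R]_(l, d + q)) (Pp : 'M[R]_(d + q)) (L : 'M[R]_d).

Let E : 'M[R]_(d + q) := block_mx 1%:M 0 0 0.
Let Ap := closed_loop A B Pp.
Let S := ulsubmx (F^T *m F).
Let D := S - ulsubmx Pp.

Hypothesis FE : F^T *m F = block_mx S 0 0 0.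
Hypothesis Ap_unit : drsubmx Ap \in unitmx.
Hypothesis Pp_are : riccati A B C Pp = 0.
Hypothesis Pp_ur : ursubmx Pp = 0.
Hypothesis Pp_sym : (ulsubmx Pp)^T = ulsubmx Pp.
Hypothesis lyapunov :
  Abar Ap *m L + L *m (Abar Ap)^T + Bbar Ap B *m (Bbar Ap B)^T = 0.
Hypothesis top_unit : forall t : R, 0 <= t -> ham_top (Abar Ap) L D t \in unitmx.

Lemma S_sym : S^T = S.
Proof.
have : (F^T *m F)^T = F^T *m F by rewrite trmx_mul trmxK.
by rewrite FE tr_block_mx => /eq_block_mx[].
Qed.

Lemma D_sym : D^T = D. Proof. by rewrite /D trmxD trmxN S_sym Pp_sym. Qed.

Lemma solution_difference (t1 t : R) (P : R -> 'M[R]_(d + q)) :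
  blocktri_gDRE E A B C F (drsubmx Pp) t1 P -> t <= t1 ->
  P t = Pp + block_mx (ulsubmx (P t - Pp)) 0 (dlsubmx (P t - Pp)) 0 /\
  (ulsubmx (P t - Pp))^T = ulsubmx (P t - Pp).
Proof.
move=> [_ Pb] tt1; have [Pur Pdr Psym] := Pb t tt1; split.
  rewrite -[LHS](subrKC Pp); congr (_ + _); rewrite -[LHS]submxK; congr block_mx.
    by rewrite submxB Pur Pp_ur subrr.
  by rewrite submxB Pdr subrr.
by rewrite submxB trmxD trmxN Psym Pp_sym.
Qed.

(** The differential equation has only algebraic content in its lower blocks,
    which fixes the lower left block of the difference. *)
Lemma solution_ric_flow (t1 : R) (P : R -> 'M[R]_(d + q)) :
  blocktri_gDRE E A B C F (drsubmx Pp) t1 P ->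
  forall t, t <= t1 ->
  ulsubmx (P t - Pp) = ric_flow (Abar Ap) L D (t1 - t).
Proof.
move=> sol t tt1; have [[dP Peq Pt1 PF] _] := sol.
pose Z s := ulsubmx (P (t1 - s) - Pp).
rewrite (_ : ulsubmx _ = Z (t1 - t)); last by rewrite /Z subKr.
apply: (ric_flow_unique lyapunov top_unit (Z := Z)); last by rewrite subr_ge0.
- move=> s s0; have st1 : t1 - s < t1 by rewrite ltrBlDr ltrDl.
  have dPs := DeriveDef (dP _ st1) erefl.
  have := is_derive_ulsubmx (is_deriveB dPs (is_derive_cst Pp (t1 - s) 1)).
  move=> dX.
  have dg := is_derive_reversed_time t1 s.
  have := @is_derive_mx_comp _ _ _ (fun u => ulsubmx ((P - cst Pp) u))
    (fun u => t1 - u) s _ (-1) dX dg.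
  rewrite scaleN1r => dZ.
  apply: (is_derive_eq dZ); rewrite subr0.
  have [PE Xs] := solution_difference sol (ltW st1).
  have := Peq _ st1; rewrite derive1E /E proj_tr_mul {1}PE riccati_shift Pp_are.
  rewrite add0r.
  have [dlE ulE] := @block_quadratic R d q m Ap B (Z s)
    (dlsubmx (P (t1 - s) - Pp)) Ap_unit Xs.
  move=> rhsE; rewrite -rhsE in dlE; rewrite -rhsE in ulE.
  move: dlE; rewrite opp_block_mx block_mxKdl oppr0 => /esym dlE.
  have : dlsubmx (P (t1 - s) - Pp) =
      - ((ursubmx Ap *m invmx (drsubmx Ap))^T *m Z s).
    have A2t : (drsubmx Ap)^T \in unitmx by rewrite unitmx_tr.
    rewrite -[LHS](mulKmx A2t); move: dlE => /eqP; rewrite addrC addr_eq0 => /eqP ->.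
    by rewrite mulmxN trmx_mul trmx_inv mulmxA.
  by move=> /ulE /(congr1 ulsubmx); rewrite opp_block_mx !block_mxKul.
- have : P (t1 - s) @[s --> 0^'+] --> P (t1 - 0).
    by rewrite subr0; exact: cvg_reversed_time.
  move=> /cvg_mxP cP; apply/cvg_mxP => i j; rewrite /Z !mxE.
  under eq_fun do rewrite !mxE.
  by apply: cvgB; [exact: cP|exact: cvg_cst].
- rewrite /Z subr0 submxB; congr (_ - _).
  by move: PF; rewrite /E proj_tr_mul FE => /eq_block_mx[].
Qed.

Lemma solution_exists (t1 : R) :
  exists P, blocktri_gDRE E A B C F (drsubmx Pp) t1 P.
Proof.
pose X := ric_flow (Abar Ap) L D.
pose H := (ursubmx Ap *m invmx (drsubmx Ap))^T.
have Xs t : 0 <= t -> (X t)^T = X t.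
  by move=> t0; apply: (ric_flow_sym lyapunov top_unit) => //; exact: D_sym.
pose P t := Pp + block_mx (X (t1 - t)) 0 (- (H *m X (t1 - t))) 0.
(* As a product with constant matrices, the block matrix inherits its
   derivative from [X]. *)
have ME (x : 'M[R]_d) : col_mx 1%:M (- H) *m x *m row_mx 1%:M 0 =
    block_mx x 0 (- (H *m x)) (0 : 'M[R]_q).
  by rewrite mul_col_mx mul_col_row mul1mx !mulmx1 !mulmx0 mulNmx.
have dPE (t : R) dx : is_derive (t1 - t) 1 X dx ->
    is_derive t 1 P (- block_mx dx 0 (- (H *m dx)) 0).
  move=> dX; have dg := is_derive_reversed_time t1 t.
  have dY := @is_derive_mx_comp _ _ _ X (fun u => t1 - u) t _ (-1) dX dg.
  have dM := is_derive_mulmxr (row_mx 1%:M (0 : 'M[R]_(d, q)))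
    (is_derive_mulmxl (col_mx 1%:M (- H)) dY).
  have := is_deriveD (is_derive_cst Pp t 1) dM.
  rewrite add0r scaleN1r mulmxN mulNmx ME; congr is_derive.
  by apply/funext => s; rewrite fctE /= ME.
have dX0 t : t <= t1 -> is_derive t 1 P
    (- block_mx ('D_1 X (t1 - t)) 0 (- (H *m 'D_1 X (t1 - t))) 0).
  move=> tt1; apply: dPE; apply: DeriveDef => //.
  by apply: (derivable_ric_flow lyapunov top_unit); rewrite subr_ge0.
exists P; split; last first.
  move=> t tt1; have t0 : 0 <= t1 - t by rewrite subr_ge0.
  have PB : P t - Pp = block_mx (X (t1 - t)) 0 (- (H *m X (t1 - t))) 0.
    by rewrite /P addrC addKr.
  split.
  - by apply/eqP; rewrite -subr_eq0 -{1}Pp_ur -submxB PB block_mxKur.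
  - by apply/eqP; rewrite -subr_eq0 -submxB PB block_mxKdr.
  - have -> : ulsubmx (P t) = ulsubmx Pp + X (t1 - t).
      by apply/eqP; rewrite addrC -subr_eq -submxB PB block_mxKul.
    by rewrite trmxD Pp_sym Xs.
split.
- by move=> t /ltW tt1; have [] := dX0 t tt1.
- move=> t tt1; have t0 : 0 < t1 - t by rewrite subr_gt0.
  have dP := dPE _ _ (is_derive_ric_flow lyapunov top_unit t0).
  rewrite derive1E; have [_ ->] := dP.
  have [_ rhsE] := @block_quadratic R d q m Ap B (X (t1 - t))
    (- (H *m X (t1 - t))) Ap_unit (Xs _ (ltW t0)).
  rewrite riccati_shift Pp_are add0r rhsE// mulmxN opprK /E proj_tr_mul.
  by rewrite block_mxKul block_mxKur.
- exact: (cvg_at_left_filter (is_derive_mx_continuous (dX0 _ (lexx t1)))).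
- rewrite /E proj_tr_mul FE /P subrr /X ric_flow0.
  by rewrite !submxD block_mxKul block_mxKur Pp_ur addr0 /D [X in block_mx X]addrC subrK.
Qed.

End SemiExplicit.

Theorem corollary5p6 (R : realType) (d q m k l : nat)
  (E A : 'M[R]_(d + q)) (B : 'M[R]_(d + q, m)) (C : 'M[R]_(k, d + q))
  (F : 'M[R]_(l, d + q)) (Pp : 'M[R]_(d + q))
  (H1 : E = block_mx 1%:M 0 0 0)
  (* range F^* is included in range E^*, as row spaces of F and E *)
  (H2 : (F <= E)%MS)
  (H3reg : regular_pair E A)
  (H3stab : stabilizing E A B C Pp)
  (H4 : psd (reduced_weight A B C (drsubmx Pp))) :
  let S := ulsubmx (F^T *m F) in
  let Ap := closed_loop A B Pp in
  let Ab := Abar Ap in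
  let Bb := Bbar Ap B in
  let D := S - ulsubmx Pp in
  let W := gramian Ab Bb in
  let Woo := gramian_oo Ab Bb in
  let solution (t1 : R) (P : R -> 'M[R]_(d + q)) :=
    blocktri_gDRE E A B C F (drsubmx Pp) t1 P in
  (* the objects in the statement are well defined *)
  [/\ forall t1 : R, 0 < t1 -> exists P, solution t1 P,
      forall tau : R, 0 <= tau -> 1%:M + W tau *m D \in unitmx,
      W tau @[tau --> +oo] --> Woo &
  (* P t1 is the solution with terminal time t1 *)
  forall P : R -> R -> 'M[R]_(d + q),
    (forall t1 : R, 0 < t1 -> solution t1 (P t1)) ->
    (forall t1 t : R, 0 < t1 -> t <= t1 ->
       ulsubmx (P t1 t - Pp) =
         expmx ((t1 - t) *: Ab^T) *m Stilde W D (t1 - t)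
           *m expmx ((t1 - t) *: Ab)) /\
    (forall t : R,
       exp_vanishes (fun t1 : R => ulsubmx (P t1 t - Pp)) <->
       1%:M + Woo *m D \in unitmx)].
Proof.
case: H3stab => -[Pp_are Pp_sym0] _ imp_free stable; subst E.
move=> S Ap Ab Bb D W Woo solution.
have [Pp_ur Pp_sym] := symmetric_pencil_blocks Pp_sym0.
have Ap_unit : drsubmx Ap \in unitmx := impulse_free_drsubmx_unit imp_free.
have expAb_decays : decays (fun t => expmx (t *: Ab)).
  exact/decays_expmx/(finite_dynamics_stable_Abar Ap_unit stable).
have [L lyap] := lyapunov_solvable (Bb *m Bb^T) expAb_decays.
have [FE S_ge0] := gram_of_subrows H2.
have weight_ge0 (x : 'cV[R]_d) : 0 <= (x^T *m (- (Ab^T *m ulsubmx Pp +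
    ulsubmx Pp *m Ab) - ulsubmx Pp *m Bb *m Bb^T *m ulsubmx Pp) *m x) 0 0.
  by rewrite -(reduced_weightE Ap_unit Pp_ur Pp_sym Pp_are); case: H4.
have top_unit (t : R) : 0 <= t -> ham_top Ab L D t \in unitmx.
  apply: (ham_top_unit lyap Pp_sym weight_ge0) => x.
  by rewrite /D subrK; exact: S_ge0.
have Wcvg : W tau @[tau --> +oo] --> L := gramian_cvg expAb_decays lyap.
have WooE : Woo = L by apply: cvg_lim Wcvg; exact: norm_hausdorff.
split.
- by move=> t1 _; exact: (solution_exists FE Ap_unit Pp_are Pp_ur Pp_sym lyap).
- exact: unit_one_add_gramian lyap top_unit.
- by rewrite WooE.
move=> P Psol.
have flowE t1 t : 0 < t1 -> t <= t1 ->
    ulsubmx (P t1 t - Pp) = ric_flow Ab L D (t1 - t).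
  move=> t10; exact: (solution_ric_flow FE Ap_unit Pp_are Pp_ur Pp_sym lyap
    top_unit (Psol t1 t10)).
split=> [t1 t t10 tt1|t].
  by rewrite flowE// (ric_flowE lyap top_unit) ?subr_ge0.
rewrite WooE.
have near_flow : \forall t1 \near +oo,
    ulsubmx (P t1 t - Pp) = ric_flow Ab L D (t1 - t).
  near=> t1; apply: flowE; near: t1.
    exact: nbhs_pinfty_gt.
  by apply: nbhs_pinfty_ge; exact: num_real.
split=> [Pv|unitL].
  apply: (ric_flow_cvg0_unit top_unit); apply: exp_vanishes_cvg0.
  apply: (exp_vanishes_shift (t := - t)) Pv.
  apply: filterS (near_pinfty_shift (- t) near_flow) => s.
  by rewrite opprK addrK => ->.
apply: exp_vanishes_shift near_flow _.
exact: (ric_flow_exp_vanishes lyap top_unit expAb_decays).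
Unshelve. all: by end_near. Qed.
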